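(* Let $a,b,c\in\mathbb{R}$ and consider the polynomial differential system $$\dot x=y,\qquad \dot y=-ax+yz,\qquad \dot z=by-cxy-x^2 .$$ The following statements hold: 1. The system has no polynomial first integrals. 2. The system has a unique irreducible Darboux polynomial, namely $y$, with cofactor $z$, if and only if $a=0$. 3. The system has no rational first integrals. 4. The system has a single exponential factor, namely $e^{x}$, with cofactor $y$. 5. The system has no first integrals of Darboux type.
   Context: Let $\mathcal{X}=y\,\partial_x+(-ax+yz)\,\partial_y+(by-cxy-x^2)\,\partial_z$ be the associated vector field. Darboux polynomial: a non-constant $f\in\mathbb{C}[x,y,z]$ such that $\mathcal{X}(f)=Kf$ for some $K\in\mathbb{C}[x,y,z]$, called the cofactor of $f$ (necessarily of degree at most $1$). Uniqueness of irreducible Darboux polynomials is understood up to multiplication by nonzero constants. Polynomial first integral: a Darboux polynomial with zero cofactor, i.e. a non-constant polynomial $f$ with $\mathcal{X}(f)=0$. Rational first integral: a non-constant rational function $f$, not a polynomial, with $\mathcal{X}(f)=0$. Exponential factor: a non-constant function $E=e^{g/h}$ with $g,h\in\mathbb{C}[x,y,z]$ coprime, such that $\mathcal{X}(E)=LE$ for some polynomial $L\in\mathbb{C}[x,y,z]$ of degree at most $1$, called the cofactor of $E$. Exponential factors are counted up to multiplication by nonzero constants and constant (complex) powers, i.e. ''a single exponential factor $e^x$'' means that the exponential factors are exactly the functions $e^{lx+c_0}$ with $l\in\mathbb{C}\setminus\{0\}$, $c_0\in\mathbb{C}$ (with cofactor $ly$). First integral of Darboux type: a (non-constant) first integral of the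 form $H=f_1^{\lambda_1}\cdots f_p^{\lambda_p}E_1^{\mu_1}\cdots E_q^{\mu_q}$, where the $f_j$ are Darboux polynomials, the $E_k$ are exponential factors, and $\lambda_j,\mu_k\in\mathbb{C}$. *)

(* Defs.v *)
From HB Require Import structures.
From mathcomp Require Import all_boot all_order all_algebra.
From mathcomp Require Import fraction complex mpoly.
From mathcomp Require Import generic_quotient ring.
From mathcomp Require Import reals sequences classical_sets topology normedtype derive exp trigo.
Import numFieldNormedType.Exports.
Set Implicit Arguments. Unset Strict Implicit. Unset Printing Implicit Defensive.
Import Order.TTheory GRing.Theory Num.Theory.
Local Open Scope ring_scope.
Local Open Scope complex_scope.
Local Open Scope classical_set_scope.

(* Typed as a numClosedFieldType so that inference finds the normed topology of
   R[i] over itself; the derivatives below are thus complex derivatives. *)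
Definition C (R : realType) : numClosedFieldType := R[i].

Definition cexp (R : realType) (z : C R) : C R :=
  (expR (complex.Re z) * cos (complex.Im z)) +i*
  (expR (complex.Re z) * sin (complex.Im z)).

Notation point R := 'rV[C R]_3.
Notation cpoly R := {mpoly (C R)[3]}.

Definition ix : 'I_3 := @Ordinal 3 0 isT.
Definition iy : 'I_3 := @Ordinal 3 1 isT.
Definition iz : 'I_3 := @Ordinal 3 2 isT.

Definition px (R : realType) : cpoly R := 'X_ix.
Definition py (R : realType) : cpoly R := 'X_iy.
Definition pz (R : realType) : cpoly R := 'X_iz.

Definition peval (R : realType) (f : cpoly R) (p : point R) : C R :=
  f.@[fun i => p ord0 i].

Definition nonconstant (R : realType) (f : cpoly R) : Prop :=
  forall k : C R, f <> k%:MP.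

Definition coprime_elts (A : idomainType) (g h : A) : Prop :=
  forall d u v : A, g = d * u -> h = d * v -> d \is a GRing.unit.

Definition irreducible_elt (A : idomainType) (f : A) : Prop :=
  [/\ f != 0, f \isn't a GRing.unit &
      forall g h : A, f = g * h -> g \is a GRing.unit \/ h \is a GRing.unit].

Lemma quotient_rule (A : idomainType) (D : A -> A) (n d : A) :
    (forall f g, D (f * g) = D f * g + f * D g) -> d != 0 ->
  let r := repr (tofrac n / tofrac d) in
  tofrac (D \n_r * \d_r - \n_r * D \d_r) / tofrac (\d_r ^+ 2) =
  tofrac (D n * d - n * D d) / tofrac (d ^+ 2).
Proof.
move=> DM d0; set q := tofrac n / tofrac d => r.
have r0 : \d_r != 0 := denom_ratioP r.
have crossE (x y z w : A) : y != 0 -> w != 0 ->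
    (tofrac x / tofrac y == tofrac z / tofrac w) = (x * w == z * y).
  by move=> y0 w0; rewrite eqr_div ?tofrac_eq0// -!tofracM tofrac_eq.
have qE : q = tofrac \n_r / tofrac \d_r.
  rewrite -[LHS](reprK q) -/r; unlock FracField.tofrac.
  rewrite -[RHS]/(FracField.mul _ (FracField.inv _)) !piE; apply/eqP.
  rewrite FracField.equivf_def /FracField.mulf /FracField.invf.
  by rewrite !numden_Ratio ?mulf_neq0 ?oner_neq0 ?numden_Ratio// ?oner_neq0//
    mul1r mulr1 mulrC.
have e : n * \d_r = \n_r * d by apply/eqP; rewrite -crossE// -qE.
have eD : D n * \d_r + n * D \d_r = D \n_r * d + \n_r * D d.
  by rewrite -!DM e.
apply/eqP; rewrite crossE ?expf_neq0//; apply/eqP.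
transitivity ((D \n_r * d + \n_r * D d) * (d * \d_r)
              - (\n_r * d) * (D d * \d_r + d * D \d_r)); first by ring.
by rewrite -eD -e; ring.
Qed.

Section System.
Variables (R : realType) (a b c : R).

Definition system (i : 'I_3) : cpoly R :=
  nth 0 [:: py R;
            - (a%:C : C R) *: px R + py R * pz R;
            (b%:C : C R) *: py R - (c%:C : C R) *: (px R * py R) - px R ^+ 2] i.

(* The vector field X acting on polynomials, on rational functions, and on
   functions C^3 -> C (through the complex partial derivatives). *)
Definition Xpoly (f : cpoly R) : cpoly R :=
  \sum_(i < 3) system i * f^`M(i).

(* The quotient rule, applied to the chosen representative of a fraction;
   the value does not depend on this choice, see Xfrac_div. *)
Definition Xfrac (f : {fraction cpoly R}) : {fraction cpoly R} :=
  let n := \n_(repr f) in let d := \d_(repr f) in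
  tofrac (Xpoly n * d - n * Xpoly d) / tofrac (d ^+ 2).

Definition Xfun (F : point R -> C R) (p : point R) : C R :=
  \sum_(i < 3) peval (system i) p * 'D_(delta_mx ord0 i) F p.

Definition darboux (f K : cpoly R) : Prop :=
  nonconstant f /\ Xpoly f = K * f.

Definition irreducible_darboux (f : cpoly R) : Prop :=
  irreducible_elt f /\ exists K : cpoly R, darboux f K.

Definition unique_irreducible_darboux (f : cpoly R) : Prop :=
  irreducible_darboux f /\
  forall g : cpoly R, irreducible_darboux g ->
    exists k : C R, k != 0 /\ g = k *: f.

Definition polynomial_first_integral (f : cpoly R) : Prop := darboux f 0.

(* Non-polynomial implies non-constant. *)
Definition rational_first_integral (f : {fraction cpoly R}) : Prop :=
  (forall g : cpoly R, f <> tofrac g) /\ Xfrac f = 0.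

(* e^(g/h); where h vanishes the value is the conventional e^0, and the
   definitions below only constrain this function where h does not vanish. *)
Definition expfrac (g h : cpoly R) (p : point R) : C R :=
  cexp (peval g p / peval h p).

(* e^(g/h) is an exponential factor with cofactor L; msize is the total degree
   plus one (and 0 for the zero polynomial). *)
Definition exp_factor_of (g h L : cpoly R) : Prop :=
  [/\ h != 0 /\ coprime_elts g h,
      exists p q : point R,
        [/\ peval h p != 0, peval h q != 0 & expfrac g h p <> expfrac g h q],
      (msize L <= 2)%N &
      forall p : point R, peval h p != 0 ->
        Xfun (expfrac g h) p = peval L p * expfrac g h p].

Definition exp_factor (E : point R -> C R) (L : cpoly R) : Prop :=
  exists g h : cpoly R, exp_factor_of g h L /\ E =1 expfrac g h.

(* phi is a branch on U of the multivalued power F^lambda, that is,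
   e^(lambda l) for a continuous branch l of log F. *)
Definition power_branch (U : set (point R)) (F : point R -> C R) (lambda : C R)
    (phi : point R -> C R) : Prop :=
  exists l : point R -> C R,
    (forall p, U p -> {for p, continuous l}) /\
    (forall p, U p -> cexp (l p) = F p /\ phi p = cexp (lambda * l p)).

(* H = f_1^lambda_1 ... f_m^lambda_m E_1^mu_1 ... E_n^mu_n on the domain U,
   with E_k = e^(g_k/h_k), for some choice of branches on U of the powers. *)
Definition darboux_function (U : set (point R)) (H : point R -> C R) : Prop :=
  exists (m n : nat) (f : 'I_m -> cpoly R) (g h : 'I_n -> cpoly R)
    (lambda : 'I_m -> C R) (mu : 'I_n -> C R)
    (phi : 'I_m -> point R -> C R) (psi : 'I_n -> point R -> C R),
    [/\ forall j, exists K, darboux (f j) K,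
        forall k, (exists L, exp_factor_of (g k) (h k) L) /\
                  (forall p, U p -> peval (h k) p != 0),
        forall j, power_branch U (peval (f j)) (lambda j) (phi j),
        forall k, power_branch U (expfrac (g k) (h k)) (mu k) (psi k) &
        forall p, U p -> H p = (\prod_(j < m) phi j p) * \prod_(k < n) psi k p].

Definition darboux_first_integral (U : set (point R)) (H : point R -> C R) :
    Prop :=
  [/\ [/\ open U, connected U & U !=set0],
      darboux_function U H,
      exists p q, [/\ U p, U q & H p <> H q] &
      forall p, U p -> Xfun H p = 0].

Lemma XpolyM (f g : cpoly R) : Xpoly (f * g) = Xpoly f * g + f * Xpoly g.
Proof.
rewrite /Xpoly mulr_suml mulr_sumr -big_split /=.
by apply: eq_bigr => i _; rewrite mderivM; ring.
Qed.

Lemma Xfrac_div (n d : cpoly R) : d != 0 ->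
  Xfrac (tofrac n / tofrac d) =
  tofrac (Xpoly n * d - n * Xpoly d) / tofrac (d ^+ 2).
Proof. exact: quotient_rule XpolyM. Qed.

End System.

(* Main.v *)
Require Import Defs.
From HB Require Import structures.
From mathcomp Require Import all_boot all_order all_algebra.
From mathcomp Require Import generic_quotient.
From mathcomp Require Import fraction complex mpoly zify ring lra.
From mathcomp Require Import boolp reals classical_sets functions topology normedtype.
From mathcomp Require Import sequences derive exp trigo.
Import numFieldNormedType.Exports.
Set Implicit Arguments. Unset Strict Implicit. Unset Printing Implicit Defensive.
Import Order.TTheory GRing.Theory Num.Theory.
Local Open Scope ring_scope.

(** Compare coefficients in X f = K f. In the top total degree, the coefficient
of maximal degree in z forces K = k0 + s z with s a natural number and the top
part of f to be a multiple of x^(n-s) y^s; one degree below, a s = 0, and f is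
constant as soon as s = k0 = 0. If K = k0 is constant, the part of f of lowest
degree in (x, y), along the line x = y = 0 of zeros of X, gives k0 = 0; if a = 0 and y does not
divide f, the restriction of f to the invariant plane y = 0 gives s = 0. Hence
Darboux polynomials exist only for a = 0, and then they are the k y^q.

For coprime g and h with X (g / h) polynomial, unique factorization in C[x,y,z]
makes h a Darboux polynomial (or a constant), and restricting to y = 0 once more
excludes h = k y^q with q > 0. This settles rational first integrals and
exponential factors.

A first integral of Darboux type is therefore, on its connected domain, of the
form exp(w log y + t x + const), whose logarithmic derivative along X is
w z + t y; it vanishes on an open set only if w = t = 0. *)

(** * Unique factorization in polynomial rings *)

Import Pdiv.Idomain.

Definition divides (A : comNzRingType) (d f : A) : Prop := exists u, f = d * u.

(** The first clause provides a size that drops strictly when a non-unit factor is removed;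
    inductions on it replace factorizations into irreducibles. The second clause says that
    irreducibles are prime. *)
Definition factorial_domain (A : idomainType) : Prop :=
  (exists mu : A -> nat, forall g h, g * h != 0 ->
     (mu g <= mu (g * h)%R)%N /\ (h \isn't a GRing.unit -> (mu g < mu (g * h)%R)%N)) /\
  (forall p g h : A, irreducible_elt p -> divides p (g * h) ->
     divides p g \/ divides p h).

Lemma dividesMr (A : comNzRingType) (d f g : A) : divides d f -> divides d (f * g).
Proof. by case=> u ->; exists (u * g); rewrite mulrA. Qed.

Lemma divides_sum (A : comNzRingType) (I : Type) (r : seq I) (P : pred I)
    (F : I -> A) (d : A) :
  (forall i, P i -> divides d (F i)) -> divides d (\sum_(i <- r | P i) F i).
Proof.
move=> dF; apply: (big_ind (divides d)) => //; first by exists 0; rewrite mulr0.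
by move=> _ _ [u ->] [v ->]; exists (u + v); rewrite mulrDr.
Qed.

Lemma irreducible_factor (A : idomainType) (f : A) : factorial_domain A ->
  f != 0 -> f \isn't a GRing.unit -> exists2 p, irreducible_elt p & divides p f.
Proof.
move=> [[mu mu_lt] _]; have [n] := ubnP (mu f).
elim: n f => // n IH f fn f0 fu.
have [firr|fred] := pselect (irreducible_elt f).
  by exists f => //; exists 1; rewrite mulr1.
have [[g h] fgh /= [gu hu]] : exists2 gh : A * A, f = gh.1 * gh.2 &
    gh.1 \isn't a GRing.unit /\ gh.2 \isn't a GRing.unit.
  apply: contrapT => N; apply: fred; split=> // g h fgh.
  apply: contrapT => /not_orP[/negP gu /negP hu].
  by apply: N; exists (g, h).
have gh0 : g * h != 0 by rewrite -fgh.
have g0 : g != 0 by apply: contraNneq gh0 => ->; rewrite mul0r.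
have [_ /(_ hu) lt_g] := mu_lt _ _ gh0.
have [|//|//|p pirr pg] := IH g; first by apply: leq_trans lt_g _; rewrite -fgh.
by exists p => //; rewrite fgh; exact: dividesMr.
Qed.

(** Irreducible factors of [h] are removed one at a time: each is prime and cannot divide [g] by
    coprimality, so it divides [u] and can be cancelled. *)
Lemma coprime_divides (A : idomainType) (g h u : A) : factorial_domain A ->
  h != 0 -> coprime_elts g h -> divides h (g * u) -> divides h u.
Proof.
move=> fA; have [[mu mu_lt] Ap] := fA; have [n] := ubnP (mu h).
elim: n h u => // n IH h u hn h0 cgh hgu.
have [hu|hu] := boolP (h \is a GRing.unit).
  by exists (h^-1 * u); rewrite mulrA divrr ?mul1r.
have [p pirr [h' hE]] := irreducible_factor fA h0 hu.
have [p0 pu _] := pirr.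
have : divides p (g * u) by case: hgu => w ->; rewrite hE; exists (h' * w); rewrite mulrA.
move=> /(Ap _ _ _ pirr)[[g' gE]|[u' uE]].
  by move: pu; rewrite (cgh p g' h').
have ph0 : h' * p != 0 by rewrite mulrC -hE.
have h'0 : h' != 0 by apply: contraNneq ph0 => ->; rewrite mul0r.
have [_ /(_ pu) lt_h] := mu_lt _ _ ph0.
have [||||w wE] := IH h' u'; rewrite ?h'0//.
- by apply: leq_trans lt_h _; rewrite mulrC -hE.
- move=> d x y gE h'E; apply: (cgh d x (p * y)) => //.
  by rewrite hE h'E; ring.
- case: hgu => w wE; exists w; apply: (mulfI p0).
  by rewrite mulrCA -uE wE hE mulrA.
by exists w; rewrite uE wE hE mulrA.
Qed.

(** As long as numerator and denominator share a non-unit factor, dividing it out lowers the size of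
    the denominator. *)
Lemma reduced_fraction (A : idomainType) (n d : A) : factorial_domain A ->
  d != 0 -> exists e g h, [/\ n = e * g, d = e * h & coprime_elts g h].
Proof.
move=> [[mu mu_lt] _]; have [k] := ubnP (mu d).
elim: k n d => // k IH n d dk d0.
have [c|nc] := pselect (coprime_elts n d); first by exists 1, n, d; rewrite !mul1r.
have [[[e g] h] /= [nE dE eu]] : exists t : A * A * A,
    [/\ n = t.1.1 * t.1.2, d = t.1.1 * t.2 & t.1.1 \isn't a GRing.unit].
  apply: contrapT => N; apply: nc => e g h nE dE.
  by apply: contrapT => /negP eu; apply: N; exists (e, g, h).
have he0 : h * e != 0 by rewrite mulrC -dE.
have h0 : h != 0 by apply: contraNneq he0 => ->; rewrite mul0r.
have [_ /(_ eu) lt_h] := mu_lt _ _ he0.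
have [|//|e' [g' [h' [gE hE c]]]] := IH g h.
  by apply: leq_trans lt_h _; rewrite mulrC -dE.
by exists (e * e'), g', h'; rewrite nE dE gE hE !mulrA.
Qed.

Lemma factorial_field (A : idomainType) :
  (forall x : A, x != 0 -> x \is a GRing.unit) -> factorial_domain A.
Proof.
move=> unitA; split; last first.
  by move=> p g h [p0 pu _]; rewrite unitA in pu.
exists (fun=> 0%N) => g h gh0; split=> //.
by rewrite unitA//; apply: contraNneq gh0 => ->; rewrite mulr0.
Qed.

Lemma factorial_iso (A B : idomainType) (f : {rmorphism A -> B}) :
  bijective f -> factorial_domain B -> factorial_domain A.
Proof.
move=> [f' fK f'K] [[mu mu_lt] Bp].
have f'M : {morph f' : x y / x * y}.
  by move=> x y; apply: (can_inj fK); rewrite rmorphM !f'K.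
have f'1 : f' 1 = 1 by rewrite -(rmorph1 f) fK.
have unitf x : (f x \is a GRing.unit) = (x \is a GRing.unit).
  apply/idP/idP => [/unitrPr[y fxy]|]; last exact: rmorph_unit.
  by apply/unitrPr; exists (f' y); apply: (can_inj fK); rewrite rmorphM f'K fxy rmorph1.
split.
  exists (mu \o f) => g h gh0 /=; rewrite rmorphM -unitf; apply: mu_lt.
  by rewrite -rmorphM; apply: contraNneq gh0 => E; rewrite -[g * h]fK E -(rmorph0 f) fK.
move=> p g h [p0 pu pirr] [u pgh].
have : divides (f p) (f g * f h) by exists (f u); rewrite -!rmorphM pgh.
case/Bp => [|[v gE]|[v gE]].
- split; first by apply: contraNneq p0 => E; rewrite -[p]fK E -(rmorph0 f) fK.
    by rewrite unitf.
  move=> x y E; rewrite -[x]f'K -[y]f'K !unitf; apply: pirr.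
  by rewrite -f'M -E fK.
- by left; exists (f' v); apply: (can_inj fK); rewrite rmorphM f'K.
- by right; exists (f' v); apply: (can_inj fK); rewrite rmorphM f'K.
Qed.

(** * Gauss's lemma for polynomials in one variable *)

Section Gauss.
Variable A : idomainType.
Hypothesis fA : factorial_domain A.
Implicit Types (f g h q d : {poly A}).

Lemma divides_polyC (x : A) f :
  (forall i, divides x f`_i) -> divides x%:P f.
Proof.
move=> xf; have [u uE] := choice xf.
exists (\poly_(i < size f) u i); apply/polyP => i.
rewrite coefCM coef_poly; case: ltnP => [_|fi]; first exact: uE.
by rewrite mulr0 nth_default.
Qed.

(** Let [i] and [j] be the lowest indices at which [x] fails to divide the coefficients of [f] and
    [g]. In the coefficient of index [i + j] of the product, every summand other than [f_i g_j] is
    divisible by [x], so this one would be too. *)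
Lemma polyC_prime (x : A) f g : irreducible_elt x ->
  divides x%:P (f * g) -> divides x%:P f \/ divides x%:P g.
Proof.
move=> xirr xfg; apply: contrapT => /not_orP[xf xg].
have least h : ~ divides x%:P h ->
    exists2 i, ~ divides x h`_i & forall j, (j < i)%N -> divides x h`_j.
  move=> xh; have /existsNP exi : ~ forall i, divides x h`_i.
    by move=> ?; apply: xh; exact: divides_polyC.
  have exb : exists i, `[< ~ divides x h`_i >] by case: exi => i ?; exists i; apply/asboolP.
  case: (ex_minnP exb) => i /asboolP xi imin; exists i => // j ji.
  by apply: contrapT => /asboolP/imin; rewrite leqNgt ji.
have [i xi li] := least _ xf; have [j xj lj] := least _ xg.
suff : divides x (f`_i * g`_j) by case/(fA.2 _ _ _ xirr).
have [w wE] : divides x (f * g)`_(i + j).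
  by case: xfg => u ->; exists u`_(i + j); rewrite coefCM.
move: wE; rewrite coefM.
have ii : (i < (i + j).+1)%N by rewrite ltnS leq_addr.
rewrite (bigD1 (Ordinal ii))//= addKn => /(canRL (addrK _)) ->.
have [v ->] : divides x (\sum_(k < (i + j).+1 | k != Ordinal ii) f`_k * g`_(i + j - k)).
  apply: divides_sum => k /eqP ki.
  have [ki'|ik|E] := ltngtP k i; last by case: ki; exact: val_inj.
    by apply: dividesMr; exact: li.
  rewrite mulrC; apply: dividesMr; apply: lj.
  by rewrite ltn_subLR ?ltn_add2r// -ltnS.
by exists (w - v); rewrite mulrBr.
Qed.

(** Each irreducible factor of [x] is prime in [{poly A}] by [polyC_prime], so it can be cancelled
    against [q] or [d]. This turns pseudo-division into division over [A]. *)
Lemma cancel_const (x : A) f q d : x != 0 -> x *: f = q * d ->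
  exists q' d' u v, [/\ f = q' * d', q = u *: q' & d = v *: d'].
Proof.
have [[mu mu_lt] _] := fA; have [n] := ubnP (mu x).
elim: n x q d => // n IH x q d xn x0 E.
have [xu|xu] := boolP (x \is a GRing.unit).
  exists (x^-1 *: q), d, x, 1; split; rewrite ?scale1r ?scalerA ?divrr ?scale1r//.
  by rewrite -scalerAl -E scalerA mulVr// scale1r.
have [p pirr [y xE]] := irreducible_factor fA x0 xu.
have [p0 pu _] := pirr.
have yp0 : y * p != 0 by rewrite mulrC -xE.
have y0 : y != 0 by apply: contraNneq yp0 => ->; rewrite mul0r.
have yn : (mu y < n)%N.
  by have [_ /(_ pu) lt_y] := mu_lt _ _ yp0; apply: leq_trans lt_y _; rewrite mulrC -xE.
have pP0 : p%:P != 0 by rewrite polyC_eq0.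
have : divides p%:P (q * d).
  by exists (y *: f); rewrite -E xE mul_polyC scalerA.
case/(polyC_prime pirr) => -[w wE].
- have [|q' [d' [u [v [-> wE' ->]]]]] := IH y w d yn y0.
    by apply: (mulfI pP0); rewrite mulrA -wE -E xE -!mul_polyC mulrA polyCM.
  by exists q', d', (p * u), v; split=> //; rewrite wE wE' mul_polyC scalerA.
- have [|q' [d' [u [v [-> -> wE']]]]] := IH y q w yn y0.
    by apply: (mulfI pP0); rewrite mulrCA -wE -E xE -!mul_polyC mulrA polyCM.
  by exists q', d', u, (p * v); split=> //; rewrite wE wE' mul_polyC scalerA.
Qed.

Lemma unit_poly_size f : f \is a GRing.unit -> size f = 1%N.
Proof. by rewrite poly_unitE => /andP[/eqP]. Qed.

Lemma polyC_unit (y : A) : (y%:P \is a GRing.unit) = (y \is a GRing.unit).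
Proof.
rewrite poly_unitE coefC eqxx size_polyC eqb1.
by have [->|//] := eqVneq y 0; rewrite unitr0.
Qed.

(** Cancelling [x] leaves [f = v *: f'] with [f'] dividing [h]. Since [f'] has positive degree it is
    not a unit, so [v] is one. *)
Lemma irreducible_pseudo_divides f h (x : A) q :
  irreducible_elt f -> (1 < size f)%N -> x != 0 -> x *: h = q * f -> divides f h.
Proof.
move=> [f0 _ firr] f1 x0 /(cancel_const x0)[q' [f' [u [v [hE qE fE]]]]].
have v0 : v != 0 by apply: contraNneq f0 => v0; rewrite fE v0 scale0r.
have := firr v%:P f'; rewrite mul_polyC => /(_ fE)[vu|/unit_poly_size f'1].
  exists (v%:P^-1 * q'); rewrite fE -mul_polyC mulrACA divrr// mul1r.
  by rewrite hE mulrC.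
by move: f1; rewrite fE size_scale// f'1.
Qed.

Lemma irreducible_polyC (x : A) : irreducible_elt x%:P -> irreducible_elt x.
Proof.
move=> [x0 xu xirr]; split; first by rewrite -polyC_eq0.
  by rewrite -polyC_unit.
by move=> g h E; rewrite -!polyC_unit; apply: xirr; rewrite E polyCM.
Qed.

(** For an irreducible [f] of positive degree, the gcd of [f] and [g] obtained by pseudo-division
    agrees up to a constant with a true factor [d'] of [f]. Either [d'] is associated to [f], which
    then divides [g], or [d'] is a unit, and [f], being coprime to [g], divides [h]. *)
Lemma factorial_poly : factorial_domain {poly A}.
Proof.
have [[mu mu_lt] _] := fA; split.
  exists (fun f => mu (lead_coef f) + size f)%N => g h gh0.
  have g0 : g != 0 by apply: contraNneq gh0 => ->; rewrite mul0r.
  have h0 : h != 0 by apply: contraNneq gh0 => ->; rewrite mulr0.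
  have lc0 : lead_coef g * lead_coef h != 0 by rewrite mulf_neq0 ?lead_coef_eq0.
  have [le_mu lt_mu] := mu_lt _ _ lc0.
  have size_gh : (size g <= size (g * h)%R)%N.
    by rewrite size_mul// -subn1 -addnBA ?size_poly_gt0// leq_addr.
  rewrite lead_coefM; split; first exact: leq_add.
  move=> hu; have [h1|h1] := ltnP 1 (size h).
    rewrite -addnS leq_add// size_mul// -subn1 -addnBA ?size_poly_gt0//.
    by rewrite -[X in (X < _)%N]addn0 ltn_add2l subn_gt0.
  rewrite -addSn leq_add//; apply: lt_mu; apply: contra hu => hu.
  by move: hu; rewrite (size1_polyC h1) lead_coefC polyC_unit.
move=> f g h firr fgh; have [f0 fu fdec] := firr.
have [f1|f1] := leqP (size f) 1.
  move: firr fgh; rewrite (size1_polyC f1) => /irreducible_polyC.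
  exact: polyC_prime.
have /Pdiv.WeakIdomain.dvdpP[[x q]/= x0 fE] := dvdp_gcdl f g.
have [q' [d' [u [v [fE' qE dE]]]]] := cancel_const x0 fE.
case: (fdec _ _ fE') => [q'u|d'u].
  left; have /Pdiv.WeakIdomain.dvdpP[[y r]/= y0 gE] := dvdp_gcdr f g.
  apply: (@irreducible_pseudo_divides f g y (r * v%:P * q'^-1)) => //.
  by rewrite gE dE fE' -mul_polyC !mulrA; congr (_ * _); rewrite mulrVK.
right; have cfg : coprimep f g.
  rewrite coprimep_def dE size_scale ?unit_poly_size//.
  apply: contraNneq f0 => v0; move: dE; rewrite v0 scale0r => /eqP.
  by rewrite gcdp_eq0 => /andP[].
have /Pdiv.WeakIdomain.dvdpP[[y r]/= y0 hE] : f %| h.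
  rewrite -(Gauss_dvdpr h cfg); apply/Pdiv.WeakIdomain.dvdpP.
  by case: fgh => w wE; exists (1, w); rewrite ?oner_neq0//= scale1r wE mulrC.
exact: irreducible_pseudo_divides hE.
Qed.

End Gauss.

(** * Passage to several variables *)

Lemma eq_mpoly_morph (n : nat) (R S : comNzRingType)
    (f g : {rmorphism {mpoly R[n]} -> S}) :
  (forall c : R, f c%:MP = g c%:MP) -> (forall i, f 'X_i = g 'X_i) -> f =1 g.
Proof.
move=> fgC fgX p; rewrite [p]mpolyE !rmorph_sum; apply: eq_bigr => m _.
rewrite -mul_mpolyC !rmorphM fgC mpolyXE_id !rmorph_prod; congr (_ * _).
by apply: eq_bigr => i _; rewrite !rmorphXn fgX.
Qed.

Section Muni.
Local Notation widen := (widen_ord (leqnSn _)).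
Variables (F : fieldType) (n : nat).

Lemma muniX_widen (i : 'I_n) :
  muni ('X_(widen i) : {mpoly F[n.+1]}) = ('X_i)%:P.
Proof.
rewrite muniE msuppX big_seq1 mcoeffX eqxx scale1r mnm1E.
case: eqP => [/(congr1 val)/= E|_]; first by move: (ltn_ord i); rewrite E ltnn.
rewrite expr0 alg_polyC; congr ('X_[_])%:P; apply/mnmP => j.
by rewrite mnmE !mnm1E.
Qed.

Lemma muniX_max : muni ('X_ord_max : {mpoly F[n.+1]}) = 'X.
Proof.
rewrite muniE msuppX big_seq1 mcoeffX eqxx scale1r mnm1E eqxx expr1.
rewrite (_ : [multinom _ | i < n] = 0%MM) ?mpolyX0 ?scale1r//.
apply/mnmP => j; rewrite mnmE mnm1E mnm0E.
by case: eqP => [/(congr1 val)/= E|//]; move: (ltn_ord j); rewrite -E ltnn.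
Qed.

Let wpoly := map_poly (@mwiden n F).
Let back (p : {poly {mpoly F[n]}}) : {mpoly F[n.+1]} := (wpoly p).['X_ord_max].

(** The inverse embeds the coefficients into [n.+1] variables and substitutes the last variable for
    ['X]. *)
Lemma muni_bij : bijective (@muni n F).
Proof.
have muniW : (@muni n F) \o (@mwiden n F) =1 polyC.
  apply: eq_mpoly_morph => [c|i] /=; first by rewrite mwidenC muniC.
  by rewrite mwidenX mnmwiden1 muniX_widen.
exists back => [p|p]; last first.
  rewrite /back /wpoly; elim/poly_ind: p => [|p c IH].
    by rewrite rmorph0 horner0 rmorph0.
  rewrite rmorphD rmorphM /= map_polyX map_polyC hornerMXaddC /=.
  by rewrite muniD muniM IH muniX_max; congr (_ + _); exact: muniW.
rewrite -[X in _ = X]/(idfun p).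
pose b := [the {rmorphism _ -> _} of horner_eval ('X_ord_max : {mpoly F[n.+1]})
   \o map_poly (@mwiden n F) \o @muni n F].
rewrite -[LHS]/(b p); apply: eq_mpoly_morph => [c|i] /=.
  by rewrite muniC map_polyC /horner_eval hornerC /= mwidenC.
have [->|[j ->]] : i = ord_max \/ exists j : 'I_n, i = widen j.
- case: (unliftP ord_max i) => [j ->|->]; [right|by left].
  by exists j; apply: val_inj; rewrite /= /bump leqNgt ltn_ord.
- by rewrite muniX_max map_polyX /horner_eval hornerX.
- by rewrite muniX_widen map_polyC /horner_eval hornerC /= mwidenX mnmwiden1.
Qed.

End Muni.

Lemma factorial_mpoly (F : fieldType) (n : nat) : factorial_domain {mpoly F[n]}.
Proof.
elim: n => [|n IH]; last exact: factorial_iso (@muni_bij F n) (factorial_poly IH).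
apply: factorial_field => p; rewrite (nvar0_mpolyC p) mpolyC_eq0 => p0.
by apply/unitrPr; exists (p@_0)^-1%:MP; rewrite -mpolyCM divff.
Qed.

(** * Coefficients of Darboux polynomials *)

(** Used to select monomials that are extremal for some degree; the induction is on the distance to
    the bound. *)
Lemma bounded_max (P : int -> Prop) (N : int) :
  (exists k, P k) -> (forall k, P k -> k <= N) ->
  exists2 k, P k & forall k', P k' -> k' <= k.
Proof.
move=> [k Pk] PN; have [n] := ubnP `|N - k|%N; elim: n k Pk => // n IH k Pk kn.
have [[k' Pk' kk']|M] := pselect (exists2 k', P k' & k < k').
  by apply: (IH k' Pk'); have := PN _ Pk'; have := PN _ Pk; lia.
exists k => // k' Pk'; case: (leP k' k) => // kk'; by case: M; exists k'.
Qed.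

Ltac vanish G Z :=
  repeat match goal with |- context [G ?i ?j ?k] =>
    rewrite (Z i j k ltac:(lia)) end.

Section Coefficients.
Variables (F : numFieldType) (a b c : F) (G : int -> int -> int -> F) (n : int).
Hypothesis G_neg : forall i j k, [|| i < 0, j < 0 | k < 0] -> G i j k = 0.
Hypothesis G_deg : forall i j k, n < i + j + k -> G i j k = 0.

Let Z0 i j k : [|| i < 0, j < 0, k < 0 | n < i + j + k] -> G i j k = 0.
Proof.
have [?|?] := boolP (n < i + j + k); first by rewrite G_deg.
by rewrite orbF; exact: G_neg.
Qed.

(** Here [G] gives the coefficients of a polynomial f of degree [n], and [k1], [k2], [k3] are those
    of the linear part of K. The equation is X f = K f in degree [n + 1], which involves only the
    quadratic part of the field and the linear part of K. *)
Lemma top_degree_part (k1 k2 k3 : F) :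
  (forall i j k, i + j + k = n + 1 ->
    j%:~R * G i j (k - 1)
      - (k + 1)%:~R * (c * G (i - 1) (j - 1) (k + 1) + G (i - 2) j (k + 1))
    = k1 * G (i - 1) j k + k2 * G i (j - 1) k + k3 * G i j (k - 1)) ->
  (exists i j k, i + j + k = n /\ G i j k != 0) ->
  exists s : int, [/\ 0 <= s, [/\ k1 = 0, k2 = 0 & k3 = s%:~R], G (n - s) s 0 != 0 &
    forall i j k, i + j + k = n -> (j != s) || (k != 0) -> G i j k = 0].
Proof.
move=> E [i' [j' [k' [d' G']]]].
have [m [i0 [j0 [d0 G0]]] mmax] :
    exists2 m, (exists i j, i + j + m = n /\ G i j m != 0) &
      forall m', (exists i j, i + j + m' = n /\ G i j m' != 0) -> m' <= m.
  apply: (@bounded_max _ n); first by exists k', i', j'.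
  move=> k [i [j [d]]]; apply: contraNle => ?; apply/eqP/Z0; lia.
have Zm i j k : [|| i < 0, j < 0, k < 0, n < i + j + k | (n == i + j + k) && (m < k)] ->
    G i j k = 0.
  have [/andP[/eqP d mk] _|_] := boolP ((n == i + j + k) && (m < k)); last first.
    by rewrite !orbF => ?; exact: Z0.
  apply/eqP; apply: contraTT mk => ?; rewrite -leNgt; apply: mmax.
  by exists i, j; split=> //; lia.
(* At z-degree [m + 1] only yz d/dy and [k3] z contribute. Hence all monomials of maximal z-degree
   [m] have the same exponent of y, namely [k3]. *)
have step1 i j : i + j + m = n -> G i j m != 0 -> k3 = j%:~R.
  move=> d G1; have := E i j (m + 1) ltac:(lia); rewrite addrK.
  vanish G Zm; rewrite !(mulr0, addr0, subr0, oppr0, add0r) => /(mulIf G1) //.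
have k3E := step1 _ _ d0 G0.
have Zj i j k : [|| i < 0, j < 0, k < 0, n < i + j + k,
    (n == i + j + k) && (m < k) | [&& n == i + j + k, k == m & j != j0]] ->
    G i j k = 0.
  have [/and3P[/eqP d /eqP k_m jj0] _|_] := boolP [&& n == i + j + k, k == m & j != j0].
    apply/eqP; apply: contraNT jj0; rewrite k_m => G1.
    rewrite -(eqr_int F) -k3E (step1 i j)//; lia.
  by rewrite !orbF => ?; exact: Zm.
have k1E : k1 = 0.
  have := E (i0 + 1) j0 m ltac:(lia); rewrite addrK k3E.
  vanish G Zj; rewrite !(mulr0, addr0, subr0) => /esym/(canRL (addrK _))/eqP.
  by rewrite subrr mulf_eq0 (negbTE G0) orbF => /eqP.
(* If [m >= 1], the comparison at x^(i0+2) y^(j0-1) z^m gives [beta0], because the factors [j0 - 1]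
   and [k3 = j0] differ. At x^(i0+2) y^j0 z^(m-1) the term - x^2 d/dz then leaves
   [m * G i0 j0 m = 0]. *)
have m0 : m = 0.
  apply/eqP; apply: contraT => mn0.
  have m1 : 1 <= m by case: (leP 0 m) G0 => [? _|? ]; [lia | rewrite Z0 ?eqxx//; lia].
  have beta0 : G (i0 + 2) (j0 - 1) (m - 1) = 0.
    have := E (i0 + 2) (j0 - 1) m ltac:(lia); rewrite k1E k3E.
    vanish G Zj; rewrite !(mulr0, mul0r, addr0, subr0, add0r).
    rewrite intrB mulrBl mul1r => /(canRL (subrK _))/esym/(canRL (addKr _)).
    by rewrite addNr.
  have := E (i0 + 2) j0 (m - 1) ltac:(lia); rewrite k1E k3E.
  rewrite beta0 subrK addrK.
  vanish G Zj; rewrite !(mulr0, mul0r, addr0, subr0, oppr0, add0r) => /eqP.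
  rewrite eq_sym -subr_eq0 opprB addrCA subrr addr0 mulf_eq0 (negbTE G0) orbF intr_eq0.
  by rewrite (negbTE mn0).
have j00 : 0 <= j0 by apply: contraNT G0 => ?; apply/eqP/Z0; lia.
exists j0; split=> //.
- split=> //; have := E i0 (j0 + 1) m ltac:(lia); rewrite addrK k1E.
  vanish G Zj; rewrite !(mulr0, mul0r, addr0, subr0, add0r, oppr0) => /esym/eqP.
  by rewrite mulf_eq0 (negbTE G0) orbF => /eqP.
- by rewrite -m0 (_ : n - j0 = i0)//; lia.
- move=> i j k d jk; apply: Zj; lia.
Qed.

(** The equation is X f = K f in degree [n]. Coefficients of degree [n - 1] enter it only through
    the quadratic part of the field and the term s z of K. Once the relevant ones are shown to
    vanish, a single equation on the top coefficient remains, with factor [a * s] in the first claim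
    and [n] in the second. *)
Lemma next_degree_part (k0 : F) (s : int) :
  0 <= s -> G (n - s) s 0 != 0 ->
  (forall i j k, i + j + k = n -> (j != s) || (k != 0) -> G i j k = 0) ->
  (forall i j k, i + j + k = n ->
    (i + 1)%:~R * G (i + 1) (j - 1) k - a * (j + 1)%:~R * G (i - 1) (j + 1) k
      + j%:~R * G i j (k - 1) + (k + 1)%:~R * (b * G i (j - 1) (k + 1)
      - c * G (i - 1) (j - 1) (k + 1) - G (i - 2) j (k + 1))
    = k0 * G i j k + s%:~R * G i j (k - 1)) ->
  (a = 0 \/ s = 0) /\ (s = 0 -> k0 = 0 -> n = 0).
Proof.
move=> s0 al0 T E.
have ZT i j k : [|| i < 0, j < 0, k < 0, n < i + j + k |
    (n == i + j + k) && ((j != s) || (k != 0))] -> G i j k = 0.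
  have [/andP[/eqP d jk] _|_] := boolP ((n == i + j + k) && ((j != s) || (k != 0))).
    exact: T.
  by rewrite orbF => ?; exact: Z0.
split.
  have [->|sn0] := eqVneq s 0; [by right | left].
  (* Downward induction on [k]: at z-degree [k + 1] the equation expresses [(j - s) * G i j k]
     through coefficients of z-degree [k + 2], and [j - s] is nonzero. *)
  have A i j k : [&& i + j + k == n - 1, j < s & 1 <= k] -> G i j k = 0.
    have [N] := ubnP `|n - k|%N; elim: N i j k => // N IH i j k kN h.
    have := E i j (k + 1) ltac:(lia); rewrite addrK.
    have -> : G (i - 1) (j - 1) (k + 1 + 1) = 0.
      by have [?|?] := leP (k + 1 + 1) n; [apply: IH; lia | apply: Z0; lia].
    have -> : G (i - 2) j (k + 1 + 1) = 0.
      by have [?|?] := leP (k + 1 + 1) n; [apply: IH; lia | apply: Z0; lia].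
    rewrite (ZT (i + 1)) ?(ZT (i - 1)) ?(ZT i (j - 1)) ?(ZT i j (k + 1)); try lia.
    rewrite !(mulr0, mul0r, addr0, subr0, oppr0, add0r) => /eqP.
    rewrite -subr_eq0 -mulrBl mulf_eq0 -intrB intr_eq0 => /orP[?|/eqP//]; lia.
  (* Of the coefficient of x^(n-s+1) y^(s-1) only [- a * s * G (n - s) s 0] survives. *)
  have := E (n - s + 1) (s - 1) 0 ltac:(lia).
  rewrite (addrK 1 (n - s)) (subrK 1 s).
  rewrite (A (n - s) (s - 1 - 1)) ?(A (n - s + 1 - 2)); try lia.
  vanish G ZT.
  rewrite !(mulr0, mul0r, addr0, subr0, oppr0, add0r, sub0r) => /eqP.
  by rewrite oppr_eq0 !mulf_eq0 (negbTE al0) orbF intr_eq0 (negbTE sn0) orbF => /eqP.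
move=> s00 k00; rewrite s00 subr0 in al0 ZT T E.
have A0 i k : i + k = n - 1 -> 1 <= k -> G i 0 k = 0.
  move=> d k1; have := E (i + 2) 0 (k - 1) ltac:(lia); rewrite subrK addrK k00.
  vanish G ZT; rewrite !(mulr0, mul0r, addr0, subr0, oppr0, add0r, sub0r) => /eqP.
  by rewrite mulrN oppr_eq0 mulf_eq0 intr_eq0 => /orP[?|/eqP//]; lia.
have A1 i k : i + k = n - 2 -> 1 <= k -> G i 1 k = 0.
  have [N] := ubnP `|n - k|%N; elim: N i k => // N IH i k kN d k1.
  have := E i 1 (k + 1) ltac:(lia); rewrite addrK k00 subrr.
  have -> : G (i - 2) 1 (k + 1 + 1) = 0.
    by have [?|?] := leP (k + 1 + 1) n; [apply: IH; lia | apply: Z0; lia].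
  rewrite (A0 (i - 1)); try lia.
  rewrite (ZT (i + 1)) ?(ZT (i - 1)) ?(ZT i 0); try lia.
  by rewrite !(mulr0, mul0r, addr0, subr0, oppr0, add0r, sub0r, mul1r).
(* By [A0] and [A1], the coefficient of x^(n-1) y reduces to [n] times that of x^n. *)
have := E (n - 1) 1 0 ltac:(lia); rewrite subrK subrr k00.
rewrite (A0 (n - 1 - 1)) ?(A1 (n - 1 - 2)); try lia.
rewrite (ZT (n - 1) 0) ?(ZT (n - 1) 1) ?(ZT (n - 1 - 1) (1 + 1)); try lia.
rewrite !(mulr0, mul0r, addr0, subr0, oppr0, add0r, sub0r, mul1r) => /eqP.
by rewrite mulf_eq0 (negbTE al0) orbF intr_eq0 => /eqP.
Qed.

(** In the part of lowest degree in (x, y), take the terms of highest degree in z. The term yz d/dy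
    forces them to be free of y, and at such a monomial x^i0 z^m every contribution of the field
    vanishes, leaving [k0 * G i0 0 m = 0]. *)
Lemma constant_cofactor (k0 : F) :
  (forall i j k,
    (i + 1)%:~R * G (i + 1) (j - 1) k - a * (j + 1)%:~R * G (i - 1) (j + 1) k
      + j%:~R * G i j (k - 1) + (k + 1)%:~R * (b * G i (j - 1) (k + 1)
      - c * G (i - 1) (j - 1) (k + 1) - G (i - 2) j (k + 1)) = k0 * G i j k) ->
  (exists i j k, G i j k != 0) -> k0 = 0.
Proof.
move=> E [i' [j' [k' G']]].
(* The least degree in (x, y) is obtained as the greatest value of [- (i + j)], so that
   [bounded_max] applies. *)
have [d1 [i1 [j1 [k1 [d1E G1]]]] dmin] : exists2 d, (exists i j k, d = - (i + j) /\ G i j k != 0) &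
      forall d', (exists i j k, d' = - (i + j) /\ G i j k != 0) -> d' <= d.
  apply: (@bounded_max _ 0); first by exists (- (i' + j')), i', j', k'.
  move=> _ [i [j [k [-> ]]]]; apply: contraNle => ?; apply/eqP/Z0; lia.
have [m [i0 [j0 [d0 G0]]] mmax] :
    exists2 m, (exists i j, - (i + j) = d1 /\ G i j m != 0) &
      forall m', (exists i j, - (i + j) = d1 /\ G i j m' != 0) -> m' <= m.
  apply: (@bounded_max _ n); first by exists k1, i1, j1.
  move=> k [i [j [_]]]; apply: contraNle => ?; apply/eqP.
  by have [?|?] := boolP ((i < 0) || (j < 0)); apply: Z0; lia.
have Zm i j k : [|| i < 0, j < 0, k < 0, d1 < - (i + j) | (d1 == - (i + j)) && (m < k)] ->
    G i j k = 0.
  move=> h; apply/eqP; apply: contraT => G2.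
  have := dmin _ (ex_intro _ i (ex_intro _ j (ex_intro _ k (conj erefl G2)))).
  have [/eqP d|d] := boolP (- (i + j) == d1).
    have := mmax k (ex_intro _ i (ex_intro _ j (conj d G2))).
    have [h'|h'] := boolP [|| i < 0, j < 0 | k < 0]; [|lia].
    by rewrite G_neg ?eqxx in G2.
  have [h'|h'] := boolP [|| i < 0, j < 0 | k < 0]; [|lia].
  by rewrite G_neg ?eqxx in G2.
have step1 i j : - (i + j) = d1 -> G i j m != 0 -> j = 0.
  move=> d G2; have := E i j (m + 1); rewrite addrK.
  vanish G Zm; rewrite !(mulr0, addr0, subr0, oppr0, add0r) => /eqP.
  by rewrite mulf_eq0 (negbTE G2) orbF intr_eq0 => /eqP.
have j00 := step1 _ _ d0 G0; rewrite j00 in d0 G0.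
have := E i0 0 m.
have -> : G (i0 - 1) (0 + 1) m = 0.
  apply/eqP; apply: contraT => G2.
  by have := step1 (i0 - 1) (0 + 1) ltac:(lia) G2.
vanish G Zm; rewrite !(mulr0, mul0r, addr0, subr0, oppr0, add0r, sub0r) => /esym/eqP.
by rewrite mulf_eq0 (negbTE G0) orbF => /eqP.
Qed.

(** On the plane y = 0, invariant for a = 0, the field is - x^2 d/dz, which lowers the degree in z,
    whereas the term [k3] z of the cofactor raises it. The comparison is made one above the top
    z-degree. *)
Lemma vertical_cofactor (k0 k3 : F) :
  (forall i k, - ((k + 1)%:~R * G (i - 2) 0 (k + 1)) = k0 * G i 0 k + k3 * G i 0 (k - 1)) ->
  (exists i k, G i 0 k != 0) -> k3 = 0.
Proof.
move=> E [i' [k' G']].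
have [m [i0 G0] mmax] : exists2 m, (exists i, G i 0 m != 0) &
    forall m', (exists i, G i 0 m' != 0) -> m' <= m.
  apply: (@bounded_max _ n); first by exists k', i'.
  move=> k [i2]; apply: contraNle => ?; apply/eqP.
  by have [?|?] := boolP (i2 < 0); apply: Z0; lia.
have Zm i k : m < k -> G i 0 k = 0.
  by move=> mk; apply/eqP; apply: contraTT mk => ?; rewrite -leNgt; apply: mmax; exists i.
have := E i0 (m + 1); rewrite addrK (Zm i0 (m + 1)) ?(Zm (i0 - 2)); try lia.
rewrite !(mulr0, oppr0, add0r) => /esym/eqP.
by rewrite mulf_eq0 (negbTE G0) orbF => /eqP.
Qed.

End Coefficients.

(** * Coefficient calculus in three variables *)

Lemma mcoeffXM (n : nat) (A : comNzRingType) (i : 'I_n) (p : {mpoly A[n]}) m :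
  ('X_i * p)@_m = if m i is 0%N then 0 else p@_(m - U_(i)).
Proof.
case E: (m i) => [|k].
  rewrite [p]mpolyE mulr_sumr raddf_sum big1//= => k _.
  rewrite -scalerAr -mpolyXD mcoeffZ mcoeffX.
  by case: eqP => [km|]; [move: E; rewrite -km mnmDE mnm1E eqxx | rewrite mulr0].
have {1}-> : m = (U_(i) + (m - U_(i)))%MM.
  by rewrite addmC submK// lep1mP E.
by rewrite mulrC mcoeffMX.
Qed.

Lemma sum_ord3 (A : nmodType) (F : 'I_3 -> A) :
  \sum_(i < 3) F i = F ix + F iy + F iz.
Proof.
rewrite !big_ord_recl big_ord0 addr0 addrA.
by congr (F _ + F _ + F _); exact: val_inj.
Qed.

Definition mnm3 (i j k : nat) : 'X_{1..3} := [multinom nth 0%N [:: i; j; k] t | t < 3].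

(* The coefficient of x^i y^j z^k, extended by 0 to negative exponents, so that
   multiplications by variables and derivations become index shifts without
   boundary cases. *)
Definition coef3 (A : nzRingType) (f : {mpoly A[3]}) (i j k : int) : A :=
  match i, j, k with
  | Posz i, Posz j, Posz k => f@_(mnm3 i j k)
  | _, _, _ => 0
  end.

Section Coef3.
Variable A : comNzRingType.
Implicit Types (f g : {mpoly A[3]}) (i j k : int).

Lemma coef3_neg f i j k : [|| i < 0, j < 0 | k < 0] -> coef3 f i j k = 0.
Proof. by case: i j k => [i|i] [j|j] [k|k]. Qed.

Lemma coef3D f g i j k : coef3 (f + g) i j k = coef3 f i j k + coef3 g i j k.
Proof. by case: i j k => [i|i] [j|j] [k|k]; rewrite /= ?addr0// mcoeffD. Qed.

Lemma coef3N f i j k : coef3 (- f) i j k = - coef3 f i j k.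
Proof. by case: i j k => [i|i] [j|j] [k|k]; rewrite /= ?oppr0// mcoeffN. Qed.

Lemma coef3Z x f i j k : coef3 (x *: f) i j k = x * coef3 f i j k.
Proof. by case: i j k => [i|i] [j|j] [k|k]; rewrite /= ?mulr0// mcoeffZ. Qed.

Lemma ord3P (P : 'I_3 -> Prop) : P ix -> P iy -> P iz -> forall t, P t.
Proof.
by move=> px py pz [[|[|[|//]]] h]; [move: px | move: py | move: pz];
  congr (P _); exact: val_inj.
Qed.

Lemma mnm3K (m : 'X_{1..3}) : m = mnm3 (m ix) (m iy) (m iz).
Proof. by apply/mnmP; apply: ord3P; rewrite mnmE. Qed.

Lemma coef3E f m : f@_m = coef3 f (m ix) (m iy) (m iz).
Proof. by rewrite {1}(mnm3K m). Qed.

Lemma mdeg3 (i j k : nat) : mdeg (mnm3 i j k) = (i + j + k)%N.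
Proof. by rewrite mdegE !big_ord_recl big_ord0 !mnmE /= addn0 addnA. Qed.

Lemma coef3_msize f i j k : (Posz (msize f) <= i + j + k) -> coef3 f i j k = 0.
Proof.
case: i j k => [i|i] [j|j] [k|k]//= h; apply/eqP.
by rewrite mcoeff_eq0 msize_mdeg_ge// mdeg3; lia.
Qed.

Lemma coef3_msize_le f (n : nat) :
  (forall i j k, Posz n <= i + j + k -> coef3 f i j k = 0) -> (msize f <= n)%N.
Proof.
move=> h; rewrite msizeE; apply/bigmax_leqP_seq => m mf _; rewrite leqNgt.
apply: contraL mf => nm; rewrite mcoeff_msupp negbK coef3E h//.
by move: nm; rewrite {1}(mnm3K m) mdeg3; lia.
Qed.

Lemma coef3_top f : f != 0 ->
  exists i j k, i + j + k = Posz (msize f).-1 /\ coef3 f i j k != 0.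
Proof.
move=> f0; exists (mlead f ix), (mlead f iy), (mlead f iz).
rewrite -coef3E mleadc_eq0 f0; split=> //.
have := mlead_deg f0; rewrite {1}(mnm3K (mlead f)) mdeg3; lia.
Qed.

Let shiftE (n : nat) : Posz n.+1 - 1 = n. Proof. lia. Qed.

Lemma coef3Mx f i j k : coef3 ('X_ix * f) i j k = coef3 f (i - 1) j k.
Proof.
case: i j k => [[|i]|i] [j|j] [k|k]//; rewrite ?shiftE//= mcoeffXM mnmE//=.
by congr mcoeff; apply/mnmP; apply: ord3P; rewrite mnmBE !mnmE/= ?mnm1E ?subn0 ?subn1.
Qed.

Lemma coef3My f i j k : coef3 ('X_iy * f) i j k = coef3 f i (j - 1) k.
Proof.
case: i j k => [i|i] [[|j]|j] [k|k]//; rewrite ?shiftE//= mcoeffXM mnmE//=.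
by congr mcoeff; apply/mnmP; apply: ord3P; rewrite mnmBE !mnmE/= ?mnm1E ?subn0 ?subn1.
Qed.

Lemma coef3Mz f i j k : coef3 ('X_iz * f) i j k = coef3 f i j (k - 1).
Proof.
case: i j k => [i|i] [j|j] [[|k]|k]//; rewrite ?shiftE//= mcoeffXM mnmE//=.
by congr mcoeff; apply/mnmP; apply: ord3P; rewrite mnmBE !mnmE/= ?mnm1E ?subn0 ?subn1.
Qed.

Let addE (n : nat) : Posz n + 1 = n.+1. Proof. lia. Qed.
Let negE (n : nat) : Negz n.+1 + 1 = Negz n. Proof. lia. Qed.

Lemma coef3_dx f i j k : coef3 f^`M(ix) i j k = (i + 1)%:~R * coef3 f (i + 1) j k.
Proof.
case: i j k => [i|[|i]] [j|j] [k|k]//; rewrite ?addE ?negE ?mulr0 ?mul0r//=.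
rewrite mcoeff_deriv mnmE/= -mulr_natl; congr (_ * mcoeff _ _).
by apply/mnmP; apply: ord3P; rewrite mnmDE !mnmE/= ?mnm1E ?addn0 ?addn1.
Qed.

Lemma coef3_dy f i j k : coef3 f^`M(iy) i j k = (j + 1)%:~R * coef3 f i (j + 1) k.
Proof.
case: i j k => [i|i] [j|[|j]] [k|k]//; rewrite ?addE ?negE ?mulr0 ?mul0r//=.
rewrite mcoeff_deriv mnmE/= -mulr_natl; congr (_ * mcoeff _ _).
by apply/mnmP; apply: ord3P; rewrite mnmDE !mnmE/= ?mnm1E ?addn0 ?addn1.
Qed.

Lemma coef3_dz f i j k : coef3 f^`M(iz) i j k = (k + 1)%:~R * coef3 f i j (k + 1).
Proof.
case: i j k => [i|i] [j|j] [k|[|k]]//; rewrite ?addE ?negE ?mulr0 ?mul0r//=.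
rewrite mcoeff_deriv mnmE/= -mulr_natl; congr (_ * mcoeff _ _).
by apply/mnmP; apply: ord3P; rewrite mnmDE !mnmE/= ?mnm1E ?addn0 ?addn1.
Qed.

Lemma coef3_field (x y z : A) f i j k :
  coef3 ('X_iy * f^`M(ix) + (- x *: 'X_ix + 'X_iy * 'X_iz) * f^`M(iy)
    + (y *: 'X_iy - z *: ('X_ix * 'X_iy) - 'X_ix ^+ 2) * f^`M(iz)) i j k =
  (i + 1)%:~R * coef3 f (i + 1) (j - 1) k
  - x * (j + 1)%:~R * coef3 f (i - 1) (j + 1) k
  + j%:~R * coef3 f i j (k - 1) + (k + 1)%:~R * (y * coef3 f i (j - 1) (k + 1)
      - z * coef3 f (i - 1) (j - 1) (k + 1) - coef3 f (i - 2) j (k + 1)).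
Proof.
rewrite expr2 !mulrDl !mulNr -!scalerAl -!mulrA !(coef3D, coef3N, coef3Z).
rewrite !(coef3Mx, coef3My, coef3Mz) !coef3_dx !coef3_dy !coef3_dz !subrK.
rewrite (_ : i - 1 - 1 = i - 2); last lia.
ring.
Qed.

Lemma coef3_affine (k0 k1 k2 k3 : A) f i j k :
  coef3 ((k0%:MP + k1 *: 'X_ix + k2 *: 'X_iy + k3 *: 'X_iz) * f) i j k =
  k0 * coef3 f i j k + k1 * coef3 f (i - 1) j k + k2 * coef3 f i (j - 1) k
  + k3 * coef3 f i j (k - 1).
Proof.
rewrite !mulrDl -!scalerAl mul_mpolyC !(coef3D, coef3Z).
by rewrite !(coef3Mx, coef3My, coef3Mz).
Qed.

Lemma msize2_affine (K : {mpoly A[3]}) : (msize K <= 2)%N ->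
  K = (K@_0%MM)%:MP + K@_U_(ix) *: 'X_ix + K@_U_(iy) *: 'X_iy + K@_U_(iz) *: 'X_iz.
Proof.
move=> K2; apply/mpolyP => m; rewrite !mcoeffD !mcoeffZ mcoeffC.
have [m2|] := leqP 2 (mdeg m).
  rewrite (memN_msupp_eq0 (msize_mdeg_ge (leq_trans K2 m2))).
  have Xm t : ('X_t : {mpoly A[3]})@_m = 0.
    by rewrite mcoeffX; case: eqP => // E; move: m2; rewrite -E mdeg1.
  rewrite !Xm !mulr0 !addr0 (_ : (m == _) = false) ?mulr0//.
  by apply/eqP => E; move: m2; rewrite E mdeg0.
rewrite ltnS leq_eqVlt ltnS leqn0 => /orP[/mdeg1P[t /eqP ->]|].
  rewrite mnm1_eq0.
  by move: t; apply: ord3P; rewrite !mcoeffXU /= !(mulr0, mulr1, addr0, add0r).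
rewrite mdeg_eq0 => /eqP ->; rewrite eqxx mulr1.
by rewrite !mcoeffX !mnm1_eq0 !mulr0 !addr0.
Qed.

End Coef3.

Section XpolyCoef.
Variables (R : realType) (a b c : R).
Implicit Types (f g : {mpoly (C R)[3]}).
Notation toC := (real_complex R : R -> C R).

Lemma XpolyE f : Xpoly a b c f =
  py R * f^`M(ix) + (- toC a *: px R + py R * pz R) * f^`M(iy)
  + (toC b *: py R - toC c *: (px R * py R) - px R ^+ 2) * f^`M(iz).
Proof.
by rewrite /Xpoly sum_ord3.
Qed.

Lemma coef3_Xpoly f (i j k : int) : coef3 (Xpoly a b c f) i j k =
  (i + 1)%:~R * coef3 f (i + 1) (j - 1) k
  - toC a * (j + 1)%:~R * coef3 f (i - 1) (j + 1) k
  + j%:~R * coef3 f i j (k - 1) + (k + 1)%:~R * (toC b * coef3 f i (j - 1) (k + 1)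
      - toC c * coef3 f (i - 1) (j - 1) (k + 1) - coef3 f (i - 2) j (k + 1)).
Proof.
by rewrite XpolyE; exact: coef3_field.
Qed.

Lemma msize_Xpoly f : (msize (Xpoly a b c f) <= (msize f).+1)%N.
Proof.
apply: coef3_msize_le => i j k h.
have Z i' j' k' : i + j + k - 1 <= i' + j' + k' -> coef3 f i' j' k' = 0.
  by move=> h'; apply: coef3_msize; apply: le_trans h'; rewrite lerBrDr -PoszD addn1.
rewrite coef3_Xpoly !Z; try lia.
by rewrite !(mulr0, subr0, addr0).
Qed.

End XpolyCoef.

(** * Darboux polynomials and rational first integrals *)

Lemma divides_X (A : comNzRingType) (f : {mpoly A[3]}) :
  (forall i k, coef3 f i 0 k = 0) -> divides ('X_iy) f.
Proof.
move=> f0; exists (\sum_(m <- msupp f) f@_m *: 'X_[m - U_(iy)]).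
rewrite {1}[f]mpolyE mulr_sumr; apply: eq_big_seq => m mf.
rewrite -scalerAr -mpolyXD addmC submK// lep1mP.
by apply: contraTneq mf => my; rewrite mcoeff_msupp negbK coef3E my f0.
Qed.

Lemma mderivXU (n : nat) (A : comNzRingType) (i j : 'I_n) :
  ('X_i : {mpoly A[n]})^`M(j) = (i == j)%:R.
Proof.
rewrite mderivX mnm1E; case: eqP => [->|_]; last by rewrite scale0r.
rewrite scale1r (_ : (U_(j) - U_(j))%MM = 0%MM) ?mpolyX0//.
by apply/mnmP => k; rewrite mnmBE subnn mnm0E.
Qed.

(** With [x] and [y] the derivatives of [n] and [d], the hypothesis is X (n / d) = l cleared of
    denominators; the conclusion exhibits [d] as a divisor of [n * y]. *)
Lemma quotient_eq (A : comNzRingType) (x y n d l : A) :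
  x * d - n * y = l * d ^+ 2 -> n * y = d * (x - l * d).
Proof. by move=> E; rewrite mulrBr mulrCA -expr2 -E; ring. Qed.

Section Darboux.
Variables (R : realType) (a b c : R).
Notation toC := (real_complex R : R -> C R).
Notation P := {mpoly (C R)[3]}.
Implicit Types (f g h K L : P).

Lemma toC_eq0 (x : R) : toC x = 0 -> x = 0.
Proof. by case. Qed.

Lemma Xpoly_py : a = 0 -> Xpoly a b c (py R) = pz R * py R.
Proof.
move=> a0; rewrite XpolyE /py !mderivXU /= a0 rmorph0 oppr0 scale0r.
by rewrite (mulr0 'X_iy) (mulr0 (_ - _)) addr0 (add0r (_ * 1)) (add0r (_ * _)) mulr1 mulrC.
Qed.

Lemma Xpoly_affine (c0 l : C R) : Xpoly a b c (c0%:MP + l *: px R) = l *: py R.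
Proof.
have lin (A : comNzRingType) (p q r x : A) : p * x + q * 0 + r * 0 = x * p by ring.
have d t : (c0%:MP + l *: px R)^`M(t) = (if ix == t then l else 0)%:MP.
  rewrite mderivD mderivC mderivZ mderivXU add0r.
  by case: eqP => _; [exact: alg_mpolyC | rewrite scaler0 mpolyC0].
rewrite XpolyE (d ix) (d iy) (d iz) eqxx.
rewrite (_ : (ix == iy) = false) // (_ : (ix == iz) = false) // mpolyC0.
by rewrite lin mul_mpolyC.
Qed.

(** The remainder [L] has smaller degree than [f], so it does not enter the two top degrees of the
    equation. It is 0 for Darboux polynomials; with [K = 0] and [L] affine the lemma serves
    exponential factors. *)
Lemma cofactor_structure f K L : (msize K <= 2)%N -> (msize L < msize f)%N ->
  Xpoly a b c f = K * f + L ->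
  exists (k0 : C R) (s : int), [/\ K = k0%:MP + s%:~R *: pz R, a = 0 \/ s = 0 &
    s = 0 -> k0 = 0 -> (msize f <= 1)%N].
Proof.
move=> /msize2_affine KE Lf E.
set k0 := K@_0 in KE; set k1 := K@_U_(ix) in KE.
set k2 := K@_U_(iy) in KE; set k3 := K@_U_(iz) in KE.
have f0 : f != 0 by apply: contraTneq Lf => ->; rewrite msize0.
have f1 : (0 < msize f)%N by rewrite lt0n msize_poly_eq0.
have [N Nf] : exists N, msize f = N.+1 by exists (msize f).-1; rewrite prednK.
have Gdeg i j k : Posz N < i + j + k -> coef3 f i j k = 0.
  by move=> h; apply: coef3_msize; rewrite Nf; move: h; lia.
have Ldeg i j k : Posz N <= i + j + k -> coef3 L i j k = 0.
  move=> h; apply: coef3_msize; by apply: le_trans h; rewrite lez_nat -ltnS -Nf.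
have Ec i j k := congr1 (fun g => coef3 g i j k) E.
have [||s [s0 [k1E k2E k3E] G0 T]] :=
    @top_degree_part _ (toC c) (coef3 f) N (@coef3_neg _ f) Gdeg k1 k2 k3.
- move=> i j k d; have := Ec i j k.
  rewrite coef3_Xpoly coef3D KE coef3_affine Ldeg; last lia.
  rewrite (Gdeg i j k) ?(Gdeg (i + 1)) ?(Gdeg (i - 1) (j + 1)) ?(Gdeg i (j - 1) (k + 1)); try lia.
  rewrite !(mulr0, subr0, addr0, add0r, sub0r) => <-; ring.
- by have := coef3_top f0; rewrite Nf.
exists k0, s; rewrite KE k1E k2E k3E !scale0r !addr0; split=> //.
all: have [|aT nT] := @next_degree_part _ (toC a) (toC b) (toC c) (coef3 f) N
  (@coef3_neg _ f) Gdeg k0 s s0 G0 T.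
- by move=> i j k d; have := Ec i j k;
    rewrite coef3_Xpoly coef3D KE coef3_affine Ldeg ?d// k1E k2E k3E !mul0r !addr0.
- by case: aT => [/toC_eq0|]; [left|right].
- by move=> i j k d; have := Ec i j k;
    rewrite coef3_Xpoly coef3D KE coef3_affine Ldeg ?d// k1E k2E k3E !mul0r !addr0.
by move=> sE kE; move: (nT sE kE) Nf => [->] ->.
Qed.

(** If [f] were of degree at least 2, [L] would be a remainder of lower degree for the cofactor 0,
    and [cofactor_structure] would make [f] constant. So [f] is affine. *)
Lemma affine_of_affine_derivative f L : (msize L <= 2)%N -> Xpoly a b c f = L ->
  exists l c0, f = c0%:MP + l *: px R /\ L = l *: py R.
Proof.
move=> L2 E; have [f2|f2] := leqP (msize f) 2; last first.
  have := @cofactor_structure f 0 L; rewrite msize0 mul0r add0r.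
  case/(_ isT (leq_ltn_trans L2 f2) E) => k0 [s [KE _ small]].
  have k00 : k0 = 0.
    by have := congr1 (mcoeff 0%MM) KE;
      rewrite mcoeff0 mcoeffD mcoeffC eqxx mulr1 mcoeffZ mcoeffX mnm1_eq0 mulr0 addr0.
  have s0 : s = 0.
    have := congr1 (mcoeff U_(iz)) KE.
    rewrite k00 mpolyC0 add0r mcoeff0 mcoeffZ mcoeffXU eqxx mulr1 => /esym/eqP.
    by rewrite intr_eq0 => /eqP.
  by move: f2; have := small s0 k00; lia.
have fE := msize2_affine f2; set c0 := f@_0 in fE; set l := f@_U_(ix) in fE.
have Ec i j k : i + j + k = 2 -> coef3 (Xpoly a b c f) i j k = 0.
  by move=> d; rewrite E; apply: coef3_msize; rewrite d lez_nat.
have F2 i j k : i + j + k = 2 -> coef3 f i j k = 0.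
  by move=> d; apply: coef3_msize; rewrite d lez_nat.
(* For affine [f], the coefficient of yz in X f is that of y in [f], and the coefficient of x^2 is
   minus that of z. *)
have fy : f@_U_(iy) = 0.
  rewrite coef3E !mnm1E /=; have := Ec 0 1 1 erefl; rewrite coef3_Xpoly.
  rewrite (F2 (0 + 1)) ?(F2 0 (1 - 1)) //.
  rewrite (@coef3_neg _ f (0 - 1)) ?(@coef3_neg _ f (0 - 1) (1 - 1)) ?(@coef3_neg _ f (0 - 2)) //.
  by rewrite !(mulr0, oppr0, subr0, addr0, add0r) mul1r.
have fz : f@_U_(iz) = 0.
  rewrite coef3E !mnm1E /=; have := Ec 2 0 0 erefl; rewrite coef3_Xpoly.
  rewrite (@coef3_neg _ f (2 + 1)) ?(@coef3_neg _ f 2 (0 - 1)) ?(@coef3_neg _ f (2 - 1) (0 - 1)) //.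
  rewrite (F2 (2 - 1)) //.
  by rewrite !(mulr0, mul0r, oppr0, subr0, addr0, add0r) mul1r => /eqP; rewrite oppr_eq0 => /eqP.
exists l, c0; rewrite fy fz !scale0r !addr0 in fE; split=> //.
by rewrite -E fE Xpoly_affine.
Qed.

(** The term [py R * h] disappears on y = 0. It is zero for Darboux polynomials, and it absorbs a
    denominator divisible by y when [f] is the numerator of a fraction. *)
Lemma vertical_cofactor_poly f K h (k0 k3 : C R) : a = 0 ->
  ~ divides (py R) f -> Xpoly a b c f = (k0%:MP + k3 *: pz R) * f + py R * h -> k3 = 0.
Proof.
move=> a0 yf E; apply: (@vertical_cofactor _ (coef3 f) (msize f) (@coef3_neg _ f) _ k0).
- by move=> i j k h'; apply: coef3_msize; exact: ltW.
- move=> i k; have := congr1 (fun g => coef3 g i 0 k) E.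
  have negy g i' k' : coef3 g i' (0 - 1) k' = 0 by apply: coef3_neg; rewrite orbT.
  rewrite coef3_Xpoly coef3D coef3My !negy.
  rewrite -[k0%:MP]addr0 -[in X in X -> _](scale0r (px R)) -[in X in X -> _](addr0 (_ + 0 *: px R)).
  rewrite -[in X in X -> _](scale0r (py R)) coef3_affine a0 rmorph0 !mul0r.
  by rewrite !(mulr0, oppr0, subr0, addr0, add0r, sub0r) mulrN.
- apply: contrapT => N; apply: yf; apply: divides_X => i k.
  by apply/eqP; apply: contraT => f0; case: N; exists i, k.
Qed.

(** X raises the degree by at most one, and degrees add under multiplication. *)
Lemma darboux_cofactor_affine f K : f != 0 -> Xpoly a b c f = K * f -> (msize K <= 2)%N.
Proof.
move=> f0 E; have [->|K0] := eqVneq K 0; first by rewrite msize0.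
have aux p q : ((p + q).-1 <= q.+1 -> 0 < q -> p <= 2)%N by lia.
apply: (@aux _ (msize f)); last by rewrite lt0n msize_poly_eq0.
by rewrite -msizeM// -E msize_Xpoly.
Qed.

Lemma darboux_trivial f K : f != 0 -> Xpoly a b c f = K * f ->
  a != 0 \/ ~ divides (py R) f -> exists2 k, k != 0 & f = k%:MP.
Proof.
move=> f0 E H; have K2 := darboux_cofactor_affine f0 E.
have := @cofactor_structure f K 0 K2; rewrite msize0 addr0 lt0n msize_poly_eq0.
case/(_ f0 E) => k0 [s [KE aS small]].
have s0 : s = 0.
  have [a0|a0] := eqVneq a 0; last by case: aS => // a0'; rewrite a0' eqxx in a0.
  case: H => [|yf]; first by rewrite a0 eqxx.
  apply/eqP; rewrite -(intr_eq0 (C R)); apply/eqP.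
  by apply: (@vertical_cofactor_poly f K 0 k0) => //; rewrite -KE E mulr0 addr0.
have k00 : k0 = 0.
  apply: (@constant_cofactor _ (toC a) (toC b) (toC c) (coef3 f) (msize f) (@coef3_neg _ f)).
  - by move=> i j k h'; apply: coef3_msize; exact: ltW.
  - move=> i j k; rewrite -coef3_Xpoly E KE s0 scale0r addr0.
    by rewrite mul_mpolyC coef3Z.
  - by have [i [j [k [_ fijk]]]] := coef3_top f0; exists i, j, k.
have := small s0 k00; rewrite leq_eqVlt ltnS leqn0 msize_poly_eq0 (negbTE f0) orbF.
by move=> /msize_poly1P.
Qed.

Lemma py_neq0 : py R != 0.
Proof. by rewrite -msize_poly_eq0 msizeX. Qed.

(** Since X y = z y, dividing [f] by y keeps it Darboux and subtracts z from the cofactor; this ends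
    at a polynomial not divisible by y, which [darboux_trivial] shows to be constant. *)
Lemma darboux_power f K : a = 0 -> f != 0 -> Xpoly a b c f = K * f ->
  exists k q, [/\ k != 0, f = k *: py R ^+ q & K = q%:R *: pz R].
Proof.
move=> a0; have [N] := ubnP (msize f); elim: N f K => // N IH f K fN f0 E.
have [[g fE]|yf] := pselect (divides (py R) f).
  have g0 : g != 0 by apply: contraNneq f0 => g0; rewrite fE g0 mulr0.
  have [||k [q [k0 gE KE]]] := IH g (K - pz R) _ g0.
  - by move: fN; rewrite fE msizeM ?py_neq0// msizeX mdeg1.
  - apply: (mulfI py_neq0); move: E; rewrite fE XpolyM Xpoly_py// => E.
    by rewrite mulrBl mulrBr (mulrCA (py R) K) -E; ring.
  exists k, q.+1; split=> //; first by rewrite fE gE exprS scalerAr.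
  by rewrite -natr1 scalerDl scale1r -KE subrK.
have [k k0 fE] := darboux_trivial f0 E (or_intror yf).
exists k, 0%N; split=> //; first by rewrite expr0 fE alg_mpolyC.
rewrite scale0r; apply/eqP; move: E; rewrite fE XpolyE !mderivC !mulr0 !addr0.
by move=> /esym/eqP; rewrite mulf_eq0 mpolyC_eq0 (negbTE k0) orbF.
Qed.

Lemma py_nunit : py R \isn't a GRing.unit.
Proof.
apply/unitrPr => -[g /(congr1 (fun p => msize p))]; rewrite msize1.
have [->|g0] := eqVneq g 0; first by rewrite mulr0 msize0.
rewrite msizeM ?py_neq0// msizeX mdeg1 => -[/eqP].
by rewrite msize_poly_eq0 (negbTE g0).
Qed.

(** The hypothesis says X (n / d) = L. Then [d] divides [n * X d], hence X d by coprimality, so it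
    is constant or, for [a = 0], of the form k y^q. If q > 0, y does not divide [n], and the
    equation for X n on y = 0 contradicts [vertical_cofactor_poly]. *)
Lemma coprime_denominator_const n d L : coprime_elts n d -> d != 0 ->
  Xpoly a b c n * d - n * Xpoly a b c d = L * d ^+ 2 ->
  exists2 k, k != 0 & d = k%:MP.
Proof.
move=> cnd d0 E.
have [K KE] : divides d (Xpoly a b c d).
  apply: (coprime_divides (factorial_mpoly _ _) d0 cnd).
  by exists (Xpoly a b c n - L * d); exact: quotient_eq E.
have KE' : Xpoly a b c d = K * d by rewrite KE mulrC.
have [a0|a0] := eqVneq a 0; last by apply: (darboux_trivial d0 KE'); left.
have [k [[|q] [k0 dE qE]]] := darboux_power a0 d0 KE'.
  by exists k => //; rewrite dE expr0 alg_mpolyC.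
have yn : ~ divides (py R) n.
  move=> [u uE]; move: py_nunit; rewrite (cnd (py R) u (k *: py R ^+ q))//.
  by rewrite dE exprS scalerAr.
have : q.+1%:R = 0 :> C R.
  (* Cancelling [d] gives X n = K n + L d, where K = (q + 1) z and L d is a multiple of y. *)
  apply: (@vertical_cofactor_poly n K (L * (k *: py R ^+ q)) 0) => //.
  rewrite mpolyC0 add0r -qE mulrCA -[_ * (k *: _)]scalerAr -exprS -dE.
  have := quotient_eq E; rewrite KE mulrCA => /(mulfI d0) nK.
  by rewrite [K * n]mulrC nK subrK.
by move/eqP; rewrite pnatr_eq0.
Qed.

End Darboux.

Lemma fraction_eq (A : idomainType) (f : {fraction A}) :
  exists n d : A, d != 0 /\ f = tofrac n / tofrac d.
Proof.
exists \n_(repr f), \d_(repr f); split; first exact: denom_ratioP.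
rewrite -[LHS]reprK; have := denom_ratioP (repr f); set r := repr f => r0.
unlock FracField.tofrac.
rewrite -[RHS]/(FracField.mul _ (FracField.inv _)) !piE; apply/eqP.
rewrite FracField.equivf_def /FracField.mulf /FracField.invf.
by rewrite !numden_Ratio ?mulf_neq0 ?oner_neq0 ?numden_Ratio// ?oner_neq0// mul1r mulr1 mulrC.
Qed.

Section Integrals.
Variables (R : realType) (a b c : R).
Notation P := {mpoly (C R)[3]}.
Implicit Types (f g h K L : P).

Lemma nonconstant_neq0 f : nonconstant f -> f != 0.
Proof. by move=> fn; apply/eqP => f0; apply: (fn 0); rewrite f0. Qed.

Lemma no_polynomial_first_integral f : ~ polynomial_first_integral a b c f.
Proof.
move=> [fn]; rewrite mul0r => E.
have [|l [c0 [fE /esym/eqP]]] := @affine_of_affine_derivative _ a b c f 0 _ E.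
  by rewrite msize0.
rewrite -mul_mpolyC mulf_eq0 mpolyC_eq0 (negbTE (py_neq0 R)) orbF => /eqP l0.
by apply: (fn c0); rewrite fE l0 scale0r addr0.
Qed.

Lemma mpolyC_unit (k : C R) : k != 0 -> (k%:MP : P) \is a GRing.unit.
Proof. by move=> k0; apply/unitrPr; exists (k^-1)%:MP; rewrite -mpolyCM divff. Qed.

Lemma irreducible_py : irreducible_elt (py R).
Proof.
split; [exact: py_neq0|exact: py_nunit|move=> g h E].
have gh0 : g * h != 0 by rewrite -E py_neq0.
have g0 : g != 0 by apply: contraNneq gh0 => ->; rewrite mul0r.
have h0 : h != 0 by apply: contraNneq gh0 => ->; rewrite mulr0.
have unit1 (f : P) : (msize f == 1)%N -> f \is a GRing.unit.
  by move/msize_poly1P => [k k0 ->]; exact: mpolyC_unit.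
have : (msize (g * h) = 2)%N by rewrite -E msizeX mdeg1.
rewrite msizeM// => gh2; have [/unit1|g1] := boolP (msize g == 1%N); first by left.
have aux p q : ((p + q).-1 = 2 -> 0 < p -> 0 < q -> p != 1 -> q == 1)%N by lia.
by right; apply: unit1; apply: aux gh2 _ _ g1; rewrite lt0n msize_poly_eq0.
Qed.

Lemma unique_py : a = 0 ->
  unique_irreducible_darboux a b c (py R) /\ darboux a b c (py R) (pz R).
Proof.
move=> a0; have dpy : darboux a b c (py R) (pz R).
  split; last exact: Xpoly_py.
  by move=> k E; have := congr1 (fun p => msize p) E; rewrite msizeX mdeg1 msizeC; case: eqP.
split=> //; split; first by split; [exact: irreducible_py|exists (pz R)].
move=> g [[g0 gu girr] [K [_ E]]].
have [k [[|q] [k0 gE _]]] := darboux_power a0 g0 E.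
  by move: gu; rewrite gE expr0 alg_mpolyC mpolyC_unit.
exists k; split=> //; case: (girr (py R) (k *: py R ^+ q)).
- by rewrite gE exprS scalerAr.
- by move=> yu; move: (py_nunit R); rewrite yu.
case: q gE => [|q] gE; first by rewrite gE expr1.
move=> u; move: (py_nunit R); rewrite exprS scalerAr unitrM in u.
by case/andP: u => ->.
Qed.

(** For [a != 0] there are no Darboux polynomials at all, hence no unique irreducible one. *)
Lemma unique_darboux_iff :
  (exists f : P, unique_irreducible_darboux a b c f) <-> a = 0.
Proof.
split=> [[f [[_ [K [fn E]]] _]]|a0]; last by exists (py R); case: (unique_py a0).
apply/eqP; apply: contrapT => /negP a0.
have [k _ fE] := darboux_trivial (nonconstant_neq0 fn) E (or_introl a0).
exact: fn fE.
Qed.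

Lemma no_rational_first_integral (f : {fraction P}) : ~ rational_first_integral a b c f.
Proof.
move=> [fnp]; have [n [d [d0 fE]]] := fraction_eq f.
have [e [g [h [nE dE cgh]]]] := reduced_fraction n (factorial_mpoly _ _) d0.
have e0 : e != 0 by apply: contraNneq d0 => e0; rewrite dE e0 mul0r.
have h0 : h != 0 by apply: contraNneq d0 => h0; rewrite dE h0 mulr0.
have {}fE : f = tofrac g / tofrac h.
  by rewrite fE nE dE !tofracM -mulf_div divff ?mul1r// tofrac_eq0.
rewrite fE Xfrac_div// => /eqP; rewrite mulf_eq0 invr_eq0 !tofrac_eq0 expf_eq0 (negbTE h0) orbF.
move/eqP => E; have [|k k0 hE] := @coprime_denominator_const _ a b c g h 0 cgh h0.
  by rewrite mul0r.
apply: (fnp (k^-1 *: g)); rewrite fE.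
apply: (canLR (mulfK _)); first by rewrite tofrac_eq0.
by rewrite -tofracM hE -scalerAl (mulrC g) mul_mpolyC scalerA mulVf// scale1r.
Qed.

End Integrals.

(** * Differentiation of the complex exponential *)

Local Open Scope classical_set_scope.

Lemma is_derive_of_cvg (K : numFieldType) (V W : normedModType K) (f : V -> W) a v l :
  (fun h : K => h^-1 *: (f (h *: v + a) - f a)) @ 0^' --> l -> is_derive a v f l.
Proof.
move=> fl; apply: DeriveDef; last exact: cvg_lim fl.
by apply/cvg_ex; exists l.
Qed.

Lemma cvg_of_is_derive (K : numFieldType) (V W : normedModType K) (f : V -> W) a v l :
  is_derive a v f l -> (fun h : K => h^-1 *: (f (h *: v + a) - f a)) @ 0^' --> l.
Proof. by case=> df <-. Qed.

Section Chain.
Variables (K : numFieldType) (V : normedModType K).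
Variables (e q : K -> K).
Hypothesis eE : forall z w, e z - e w = e w * q (z - w) * (z - w).
Hypothesis e_neq0 : forall z, e z != 0.
Hypothesis q1 : q z @[z --> (0 : K)] --> (1 : K).
Implicit Types (p v : V) (F G : V -> K).

Lemma cvg_line p v : (h *: v + p) @[h --> (0 : K)^'] --> p.
Proof.
have : (h *: v + p) @[h --> (0 : K)^'] --> 0 *: v + p.
  apply: cvgD; last exact: cvg_cst.
  apply: cvgZ; last exact: cvg_cst.
  by apply: cvg_within_filter; exact: cvg_id.
by rewrite scale0r add0r.
Qed.

(** By [eE] and [q1], [q] is the difference quotient of [e] with its value at 0 filled in. Factoring
    through it avoids dividing by the increment of [G], which may vanish. *)
Lemma is_derive_exp_comp p v G dG : is_derive p v G dG ->
  is_derive p v (fun x => e (G x)) (e (G p) * dG).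
Proof.
move=> /cvg_of_is_derive GdG; apply: is_derive_of_cvg.
have G0 : (G (h *: v + p) - G p) @[h --> (0 : K)^'] --> (0 : K).
  have : (h *: (h^-1 *: (G (h *: v + p) - G p))) @[h --> (0 : K)^'] --> 0 *: dG.
    by apply: cvgZ => //; apply: cvg_within_filter; exact: cvg_id.
  rewrite scale0r; apply: cvg_trans; apply: near_eq_cvg.
  by near=> h; rewrite scalerA divff ?scale1r//; near: h; exact: nbhs_dnbhs_neq.
have qG := cvg_comp _ _ G0 q1.
have -> : (fun h : K => h^-1 *: (e (G (h *: v + p)) - e (G p))) =
    (fun h => e (G p) * (q (G (h *: v + p) - G p) * (h^-1 *: (G (h *: v + p) - G p)))).
  by apply/funext => h; rewrite eE scalerAr -mulrA.
apply: cvgM; first exact: cvg_cst.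
by rewrite -[dG]mul1r; apply: cvgM.
Unshelve. all: by end_near. Qed.

(** Continuity of [G] keeps the factor [q] of its increment close to 1, hence invertible; the
    difference quotient of [G] is that of [F] divided by [F p * q]. *)
Lemma is_derive_log_branch p v F G dF : {for p, continuous G} ->
  (\forall x \near p, e (G x) = F x) -> is_derive p v F dF ->
  is_derive p v G (dF / F p).
Proof.
move=> Gp GF /cvg_of_is_derive FdF; apply: is_derive_of_cvg.
have G0 : (G (h *: v + p) - G p) @[h --> (0 : K)^'] --> (0 : K).
  have : (G (h *: v + p) - G p) @[h --> (0 : K)^'] --> G p - G p.
    apply: cvgB; last exact: cvg_cst.
    exact: (cvg_comp _ _ (@cvg_line p v) Gp).
  by rewrite subrr.
have qG := cvg_comp _ _ G0 q1.
have Fp : e (G p) = F p by exact: nbhs_singleton GF.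
have F0 : F p != 0 by rewrite -Fp e_neq0.
have : ((h^-1 *: (F (h *: v + p) - F p)) *
    (F p * q (G (h *: v + p) - G p))^-1) @[h --> (0 : K)^'] --> dF / (F p * 1).
  apply: cvgM => //; apply: cvgV; first by rewrite mulr1.
  by apply: cvgM => //; exact: cvg_cst.
rewrite mulr1; apply: cvg_trans; apply: near_eq_cvg.
have nearF : \forall h \near (0 : K)^', e (G (h *: v + p)) = F (h *: v + p).
  exact: (@cvg_line p v _ GF).
have nearq : \forall h \near (0 : K)^', q (G (h *: v + p) - G p) != 0.
  by apply: (cvgr_neq0 _ qG); rewrite oner_neq0.
near=> h.
have -> : F (h *: v + p) = e (G (h *: v + p)) by apply/esym; near: h.
have q0 : q (G (h *: v + p) - G p) != 0 by near: h.
by rewrite -Fp eE -scalerAl mulrAC mulfV ?mul1r// mulf_neq0.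
Unshelve. all: by end_near. Qed.

End Chain.

(** * The complex derivative of the exponential at 0 *)

Section ComplexExponential.
Variable R : realType.
Implicit Types (z w : C R) (x y : R).

Lemma cexpD z w : cexp (z + w) = cexp z * cexp w.
Proof.
case: z w => [x y] [x' y']; rewrite /cexp /= expRD cosD sinD.
apply/eqP; rewrite eq_complex /=; apply/andP; split; apply/eqP; ring.
Qed.

Lemma cexp0 : cexp (0 : C R) = 1.
Proof. by rewrite /cexp /= expR0 cos0 sin0 !mul1r. Qed.

Lemma cexp_neq0 z : cexp z != 0.
Proof.
apply/eqP => z0; have := oner_neq0 (C R).
by rewrite -cexp0 -{1}(addrN z) cexpD z0 mul0r eqxx.
Qed.

Lemma linear_approx (f : R -> R) (d : R) : is_derive (0 : R) (1 : R) f d ->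
  forall e : R, 0 < e -> \forall h \near (0 : R), `|f h - f 0 - d * h| <= e * `|h|.
Proof.
move=> /cvg_of_is_derive/cvgrPdist_le fd e e0.
have /nbhs_ballP[r r0 br] := fd e e0.
apply/nbhs_ballP; exists r => // h hr.
have [->|h0] := eqVneq h 0; first by rewrite subrr mulr0 subrr normr0 mulr0.
have := br h hr h0; rewrite /= scaler1 addr0 distrC => fh.
rewrite -(mulfVK h0 (f h - f 0)) -mulrBl normrM ler_wpM2r//.
by rewrite mulrC.
Qed.

Lemma near_ReIm (P : R -> Prop) : (\forall x \near (0 : R), P x) ->
  nbhs (0 : C R) [set z : C R | P (complex.Re z) /\ P (complex.Im z)].
Proof.
move=> /nbhs_ballP[r r0 rP]; apply/nbhs_ballP.
have r0' : (0 : C R) < r%:C%C by rewrite ltcR.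
exists (r%:C)%C => // z; rewrite /ball /= sub0r normrN => zr.
have small x : (`|x|%:C <= `|z|)%C -> P x.
  move=> xz; apply: rP; rewrite /ball /= sub0r normrN -ltcR.
  exact: le_lt_trans xz zr.
split; apply: small; first exact: normc_ge_Re.
(* The imaginary part is minus the real part of [z * 'i], so the bound for real parts applies
   again. *)
have := normc_ge_Re (z * 'i%C); rewrite ReiNIm normrN normrM.
by rewrite (_ : `|'i%C| = 1 :> C R) ?mulr1// normc_def /= expr0n expr1n add0r sqrtr1.
Qed.

Lemma normc_le_ReIm z : `|z| <= (`|complex.Re z| + `|complex.Im z|)%:C%C.
Proof.
rewrite normc_def lecR; set x := complex.Re z; set y := complex.Im z.
have xy0 : 0 <= `|x| + `|y| by rewrite addr_ge0.
rewrite -[leRHS]ger0_norm// -(sqrtr_sqr (_ + _)) ler_wsqrtr// sqrrD !real_normK ?num_real//.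
by rewrite -addrA lerD2l lerDr mulrn_wge0// mulr_ge0.
Qed.

(** The real estimate behind the derivative at 0: [E], [co], [si] stand for exp x, cos y, sin y and
    [n] for the modulus of x + iy. The two terms are at most [3 * (d * n)] and [5 * (d * n)], which
    the constant 12 covers. *)
Lemma cexp_estimate (d e n E co si x y : R) : 12 * d <= e -> 0 < d -> d <= 1 ->
  `|co| <= 1 -> `|E - 1 - x| <= d * `|x| -> `|x| <= d -> `|y| <= d ->
  `|co - 1| <= d * `|y| -> `|si - y| <= d * `|y| -> `|x| <= n -> `|y| <= n ->
  `|E * co - 1 - x| + `|E * si - y| <= e * n.
Proof.
move=> de d0 d1 co1 Ex xd yd coy siy xn yn.
have n0 : 0 <= n by apply: le_trans xn.
have Exn : `|E - 1 - x| <= d * n by apply: le_trans Ex _; rewrite ler_pM2l.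
have con : `|co - 1| <= d * n by apply: le_trans coy _; rewrite ler_pM2l.
have sin : `|si - y| <= d * n by apply: le_trans siy _; rewrite ler_pM2l.
have h1 : `|E * co - 1 - x| <= 3 * (d * n).
  rewrite (_ : _ - _ - _ = (E - 1 - x) * co + (1 + x) * (co - 1)); last ring.
  apply: le_trans (ler_normD _ _) _; rewrite !normrM.
  have -> : 3 * (d * n) = d * n * 1 + 2 * (d * n) by ring.
  apply: lerD; apply: ler_pM => //.
  by apply: le_trans (ler_normD _ _) _; rewrite normr1; lra.
have h2 : `|E * si - y| <= 5 * (d * n).
  rewrite (_ : _ - _ = (E - 1 - x + x) * (si - y + y) + (si - y)); last ring.
  apply: le_trans (ler_normD _ _) _; rewrite normrM.
  have -> : 5 * (d * n) = (2 * d) * (2 * n) + d * n by ring.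
  apply: lerD => //; apply: ler_pM => //; apply: le_trans (ler_normD _ _) _.
    apply: le_trans (lerD Ex xd) _; rewrite mulr_natl mulr2n lerD2r.
    by rewrite ler_piMr ?(ltW d0) // (le_trans xd).
  by have : d * n <= n by [rewrite ler_piMl]; lra.
apply: le_trans (lerD h1 h2) _; rewrite -mulrDl mulrA.
by rewrite ler_wpM2r//; lra.
Qed.

Lemma cexp_approx (e : R) : 0 < e ->
  nbhs (0 : C R) [set z : C R | `|cexp z - 1 - z| <= (e%:C%C : C R) * `|z|].
Proof.
move=> e0; pose d := Num.min 1 (e / 12).
have d0 : 0 < d by rewrite lt_min ltr01 divr_gt0.
have d1 : d <= 1 by rewrite ge_min lexx.
have de : 12 * d <= e by rewrite mulrC -ler_pdivlMr// ge_min lexx orbT.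
have expA := linear_approx (is_derive_expR 0) d0.
have cosA := linear_approx (is_derive_cos 0) d0.
have sinA := linear_approx (is_derive_sin 0) d0.
have xd : \forall x \near (0 : R), `|x| <= d.
  by apply/nbhs_ballP; exists d => // x; rewrite /ball /= sub0r normrN => /ltW.
pose nearI := @filterI _ _ (nbhs_filter (0 : R)).
have B := near_ReIm (nearI _ _ (nearI _ _ expA xd) (nearI _ _ cosA sinA)).
apply: filterS B => z.
case; rewrite /setI /= expR0 cos0 sin0 oppr0 !mul0r !mul1r !subr0 !addr0.
move=> -[[exA xd1] [_ _]] [[_ yd] [cyA syA]].
have := normc_ge_Re z; have := normc_ge_Re (z * 'i%C).
rewrite ReiNIm normrN normrM (_ : `|'i%C| = 1 :> C R); last first.
  by rewrite normc_def /= expr0n expr1n add0r sqrtr1.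
rewrite mulr1 normc_def; set n := Num.sqrt _; rewrite !lecR => yn xn.
apply: le_trans (normc_le_ReIm _) _; rewrite -rmorphM lecR.
have -> : complex.Re (cexp z - 1 - z) = expR (complex.Re z) * cos (complex.Im z) - 1 - complex.Re z.
  by case: z {exA xd1 yd cyA syA yn xn n}.
have -> : complex.Im (cexp z - 1 - z) = expR (complex.Re z) * sin (complex.Im z) - complex.Im z.
  by case: z {exA xd1 yd cyA syA yn xn n} => x y; rewrite /= subr0.
exact: (cexp_estimate de d0 d1 (cos_max _) exA xd1 yd cyA syA xn yn).
Qed.

(** The value 1 at 0 fills the removable singularity, so that [cexpqE] holds without exception. *)
Definition cexpq z : C R := if z == 0 then 1 else (cexp z - 1) / z.

Lemma cexpqE z w : cexp z - cexp w = cexp w * cexpq (z - w) * (z - w).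
Proof.
rewrite /cexpq; have [zw|zw] := eqVneq (z - w) 0.
  by rewrite zw mulr0; move/eqP: zw; rewrite subr_eq0 => /eqP ->; rewrite subrr.
by rewrite -mulrA divfK// mulrBr mulr1 -cexpD (addrC w) subrK.
Qed.

Lemma cvg_cexpq : cexpq @ (0 : C R) --> (1 : C R).
Proof.
apply/(@cvgrPdist_le _ _ _ _ (nbhs_filter (0 : C R))) => e e0.
have e0R : 0 < complex.Re e by move: e0; rewrite ltcE => /andP[].
have eE : e = (complex.Re e)%:C%C by rewrite RRe_real// gtr0_real.
apply: filterS (cexp_approx e0R) => z /= ze.
rewrite /cexpq; have [_|z0] := eqVneq z 0; first by rewrite subrr normr0 ltW.
rewrite -(ler_pM2r (_ : 0 < `|z|)) ?normr_gt0// -normrM mulrBl mul1r divfK//.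
by rewrite distrC {1}eE.
Qed.

End ComplexExponential.

(** * Polynomials as functions *)

Lemma poly_many_roots (F : numDomainType) (p : {poly F}) :
  (forall x, p.[x] = 0) -> p = 0.
Proof.
move=> p0; apply/eqP; apply: contraT => pn0.
have := @max_poly_roots _ p [seq i%:R | i <- iota 0 (size p)] pn0.
rewrite size_map size_iota ltnn => -> //; first by apply/allP => x _; apply/eqP.
by rewrite map_inj_uniq ?iota_uniq//; move=> i j /eqP; rewrite eqr_nat => /eqP.
Qed.

(** Induction on the number of variables: with the first [n] values fixed, the polynomial in the
    last variable vanishes everywhere, so each of its coefficients vanishes at [v]. *)
Lemma mpoly_eval_eq0 (F : numFieldType) (n : nat) (p : {mpoly F[n]}) :
  (forall v : 'I_n -> F, p.@[v] = 0) -> p = 0.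
Proof.
elim: n p => [|n IH] p p0.
  by have := p0 (fun=> 0); rewrite (nvar0_mpolyC p) mevalC => ->; rewrite mpolyC0.
apply: (bij_inj (muni_bij F n)); rewrite muni0; apply/polyP => i; rewrite coef0.
apply: IH => v.
suff -> : ((muni p)`_i).@[v] = (map_poly (meval v) (muni p))`_i.
  rewrite (@poly_many_roots _ (map_poly (meval v) (muni p))) ?coef0// => x.
  pose w (k : 'I_n.+1) := if unlift ord_max k is Some j then v j else x.
  rewrite -(p0 w).
  pose ev := [the {rmorphism _ -> _} of horner_eval x \o map_poly (meval v) \o @muni n F].
  rewrite -[LHS]/(ev p); apply: eq_mpoly_morph => [c|k] /=.
    by rewrite mevalC muniC map_polyC /horner_eval hornerC /= mevalC.
  rewrite mevalXU /w; case: unliftP => [j ->|->].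
    rewrite (_ : lift ord_max j = widen_ord (leqnSn _) j).
      by rewrite muniX_widen map_polyC /horner_eval hornerC /= mevalXU.
    by apply: val_inj; rewrite /= /bump leqNgt ltn_ord.
  by rewrite muniX_max map_polyX /horner_eval hornerX.
by rewrite coef_map.
Qed.

Section PolyDerive.
Variables (K : numFieldType) (n : nat).
Implicit Types (p : 'rV[K]_n) (f g : {mpoly K[n]}).

Definition reval f p : K := f.@[fun i => p ord0 i].

Lemma is_derive_coord p (v : 'rV[K]_n) (i : 'I_n) :
  is_derive p v (fun q : 'rV[K]_n => q ord0 i) (v ord0 i).
Proof.
apply: is_derive_of_cvg.
have : cst (v ord0 i) @ (0 : K)^' --> v ord0 i by exact: cvg_cst.
apply: cvg_trans; apply: near_eq_cvg; near=> h.
rewrite !mxE addrK /GRing.scale /= mulrA mulVf ?mul1r//.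
by near: h; exact: nbhs_dnbhs_neq.
Unshelve. all: by end_near. Qed.

(** The property [D] holds for constants and variables and is stable under sums and products. *)
Lemma is_derive_reval f p (i : 'I_n) :
  is_derive p (delta_mx ord0 i) (reval f) (reval f^`M(i) p).
Proof.
pose D g := is_derive p (delta_mx ord0 i) (reval g) (reval g^`M(i) p).
have DC c : D c%:MP.
  rewrite /D mderivC /reval meval0 (_ : (fun _ => _) = cst c); first exact: is_derive_cst.
  by apply/funext => q; rewrite mevalC.
have DM g h : D g -> D h -> D (g * h).
  move=> Dg Dh; rewrite /D (_ : reval (g * h) = reval g * reval h); last first.
    by apply/funext => q; rewrite /reval mevalM.
  apply: (is_derive_eq (is_deriveM Dg Dh)).
  rewrite mderivM /reval mevalD !mevalM /GRing.scale /=; ring.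
have DD g h : D g -> D h -> D (g + h).
  move=> Dg Dh; rewrite /D (_ : reval (g + h) = reval g + reval h); last first.
    by apply/funext => q; rewrite /reval mevalD.
  by apply: (is_derive_eq (is_deriveD Dg Dh)); rewrite mderivD /reval mevalD.
have DX j : D 'X_j.
  have := is_derive_coord p (delta_mx ord0 i) j.
  rewrite /D mxE eqxx /= mderivXU eq_sym.
  rewrite (_ : reval 'X_j = fun q => q ord0 j); last by apply/funext => q; rewrite /reval mevalXU.
  by rewrite /reval; case: eqP => _; rewrite ?meval1 ?meval0.
have D1 : D 1 by have := DC 1; rewrite mpolyC1.
rewrite [f]mpolyE; apply: (big_ind D); [|exact: DD|].
  by have := DC 0; rewrite mpolyC0.
move=> m _; rewrite -mul_mpolyC mpolyXE_id; apply: (DM) => //.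
apply: (big_ind D); [exact: D1|exact: DM|move=> j _].
by elim: (m j) => [|k IH]; [rewrite expr0 | rewrite exprS; apply: (DM)].
Qed.

End PolyDerive.

(** * Continuous logarithms on connected sets *)

Section Connected.
Variables (R : realType) (V : normedModType (C R)).

(* A nonzero z with cexp z = 1 has a zero difference quotient, so the solutions
   of cexp z = 1 are isolated. *)
Lemma cexp_eq1_isolated : \forall z \near (0 : C R), cexp z = 1 -> z = 0.
Proof.
have qn0 : \forall z \near (0 : C R), cexpq z != 0.
  by apply: (@cvgr_neq0 _ _ _ _ (nbhs_filter (0 : C R)) _ _ (@cvg_cexpq R)); rewrite oner_neq0.
near=> z => z1; have : cexpq z != 0 by near: z.
by have [//|z0] := eqVneq z 0; rewrite /cexpq (negbTE z0) z1 subrr mul0r eqxx.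
Unshelve. all: by end_near. Qed.

(** Near any point of [U] the increments of [l] are small solutions of [cexp z = 1], hence zero. The
    level set of [l] through [p] is therefore open and closed in [U]. *)
Lemma locally_constant (U : set V) (l : V -> C R) :
  open U -> connected U -> (forall p, U p -> {for p, continuous l}) ->
  (forall p, U p -> \forall q \near p, cexp (l q) = cexp (l p)) ->
  forall p q, U p -> U q -> l p = l q.
Proof.
move=> Uo Uc lc lU p q Up Uq.
pose B := [set x | U x /\ l x = l p].
have near_l x : U x -> \forall y \near x, l y = l x.
  move=> Ux.
  have d0 : (l y - l x) @[y --> x] --> (0 : C R).
    have : (l y - l x) @[y --> x] --> l x - l x by apply: cvgB; [exact: lc | exact: cvg_cst].
    by rewrite subrr.
  have isolated := d0 _ cexp_eq1_isolated.
  near=> y; apply/eqP; rewrite -subr_eq0; apply/eqP.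
  have E : cexp (l y) = cexp (l x) by near: y; exact: lU.
  have : cexp (l y - l x) = 1 -> l y - l x = 0 by near: y.
  by apply; rewrite cexpD E -cexpD addrN cexp0.
have BU : B = U.
  apply: Uc.
  - by exists p.
  - exists B; last by rewrite predeqE => x; split=> [[? ?]|[]//].
    rewrite openE => x [Ux lx]; near=> y.
    split; first by near: y; exact: open_nbhs_nbhs.
    by rewrite -lx; near: y; exact: near_l.
  - exists (~` [set x | U x /\ l x != l p]).
      apply: open_closedC; rewrite openE => x [Ux lx]; near=> y.
      split; first by near: y; exact: open_nbhs_nbhs.
      suff -> : l y = l x by [].
      by near: y; exact: near_l.
    rewrite predeqE => x; split=> [[Ux lx]|[Ux nx]]; split=> //.
      by case=> _; rewrite lx eqxx.
    by apply: contrapT => lx; apply: nx; split=> //; apply/eqP.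
by have [] : B q by rewrite BU.
Unshelve. all: by end_near. Qed.

End Connected.

(** * Exponential factors *)

Lemma is_derive_div (K : numFieldType) (V : normedModType K) (f g : V -> K) p v df dg :
  g p != 0 -> is_derive p v f df -> is_derive p v g dg ->
  is_derive p v (fun q => f q / g q) ((df * g p - f p * dg) / g p ^+ 2).
Proof.
move=> g0 Df Dg.
have Dgi : is_derive p v (fun q => (g q)^-1) (- (g p) ^- 2 * dg).
  by apply: DeriveDef; [exact: derivableV | rewrite deriveV// derive_val].
apply: (is_derive_eq (is_deriveM Df Dgi)); rewrite /GRing.scale /=.
by field.
Qed.

Lemma lie_quotient (K : fieldType) (n : nat) (s u v : 'I_n -> K) (E x y : K) :
  \sum_(i < n) s i * (E * ((u i * y - x * v i) / y ^+ 2)) =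
  E * (((\sum_(i < n) s i * u i) * y - x * (\sum_(i < n) s i * v i)) / y ^+ 2).
Proof.
rewrite mulr_suml mulr_sumr -sumrB mulr_suml mulr_sumr; apply: eq_bigr => i _.
ring.
Qed.

Lemma ratio_eq (F : fieldType) (x y e l : F) : y != 0 -> e != 0 ->
  e * (x / y ^+ 2) = l * e -> x = l * y ^+ 2.
Proof.
move=> y0 e0; rewrite [RHS]mulrC => /(mulfI e0) <-.
by rewrite divfK// expf_neq0.
Qed.

Section ExpFactors.
Variables (R : realType) (a b c : R).
Notation P := {mpoly (C R)[3]}.
Notation point := 'rV[C R]_3.
Implicit Types (f g h K L : P) (p q : point).

Lemma is_derive_cexp (V : normedModType (C R)) (G : V -> C R) (p v : V) dG :
  is_derive p v G dG -> is_derive p v (fun x => cexp (G x)) (cexp (G p) * dG).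
Proof. exact: (is_derive_exp_comp (@cexpqE R) (@cvg_cexpq R)). Qed.

Lemma is_derive_clog (V : normedModType (C R)) (F G : V -> C R) (p v : V) dF :
  {for p, continuous G} -> (\forall x \near p, cexp (G x) = F x) ->
  is_derive p v F dF -> is_derive p v G (dF / F p).
Proof. exact: (is_derive_log_branch (@cexpqE R) (@cexp_neq0 R) (@cvg_cexpq R)). Qed.

Lemma is_derive_expfrac g h p i : peval h p != 0 ->
  is_derive p (delta_mx ord0 i) (expfrac g h) (expfrac g h p *
   ((peval g^`M(i) p * peval h p - peval g p * peval h^`M(i) p) / peval h p ^+ 2)).
Proof.
move=> h0; apply: is_derive_cexp; apply: is_derive_div => //; exact: is_derive_reval.
Qed.

Lemma peval_Xpoly f p : peval (Xpoly a b c f) p =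
  \sum_(i < 3) peval (system a b c i) p * peval f^`M(i) p.
Proof.
rewrite /peval /Xpoly (big_morph _ (mevalD _) (meval0 _)).
by apply: eq_bigr => i _; rewrite mevalM.
Qed.

Lemma Xfun_expfrac g h p : peval h p != 0 ->
  Xfun a b c (expfrac g h) p = expfrac g h p *
    (peval (Xpoly a b c g * h - g * Xpoly a b c h) p / peval h p ^+ 2).
Proof.
move=> h0; rewrite /Xfun; under eq_bigr => i _ do
  rewrite (@derive_val _ _ _ _ _ _ _ (is_derive_expfrac g i h0)).
rewrite lie_quotient; congr (_ * (_ / _)).
have pevalBM (u1 u2 u3 u4 : P) : peval (u1 * u2 - u3 * u4) p =
    peval u1 p * peval u2 p - peval u3 p * peval u4 p.
  by rewrite /peval mevalB !mevalM.
by rewrite pevalBM !peval_Xpoly.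
Qed.

Lemma XpolyC (k : C R) : Xpoly a b c k%:MP = 0.
Proof. by rewrite XpolyE !mderivC !mulr0 !addr0. Qed.

(** Where [h] does not vanish, the equation for e^(g/h) amounts to X (g / h) = L. This forces [h] to
    be a constant k, and then g / k has an affine derivative. *)
Lemma exp_factor_ofP g h L : exp_factor_of a b c g h L ->
  exists l c0 : C R, [/\ l != 0, L = l *: py R &
    forall p, peval h p != 0 /\ expfrac g h p = cexp (l * p ord0 ix + c0)].
Proof.
move=> [[h0 cgh] [p [q [hp hq Epq]]] L2 EX].
have E : Xpoly a b c g * h - g * Xpoly a b c h = L * h ^+ 2.
  (* The identity is known pointwise only off the zeros of [h]; multiplied by [h] it holds
     everywhere. *)
  apply/eqP; rewrite -subr_eq0; apply/eqP; apply: (mulIf h0); rewrite mul0r.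
  apply: mpoly_eval_eq0 => v; rewrite mevalM.
  have [->|hv] := eqVneq h.@[v] 0; first by rewrite mulr0.
  pose r : point := \row_i v i.
  have rv f : peval f r = f.@[v] by apply: meval_eq => i; rewrite mxE.
  have hr : peval h r != 0 by rewrite rv.
  have Er := ratio_eq hr (cexp_neq0 _) (etrans (esym (Xfun_expfrac g hr)) (EX r hr)).
  have pevalB2 (u1 u2 u3 : P) : peval (u1 - u2 * u3 ^+ 2) r =
      peval u1 r - peval u2 r * peval u3 r ^+ 2.
    by rewrite /peval mevalB mevalM rmorphXn.
  by rewrite -rv pevalB2 Er subrr mul0r.
have [k k0 hE] := coprime_denominator_const cgh h0 E.
have Xg : Xpoly a b c (k^-1 *: g) = L.
  rewrite -mul_mpolyC XpolyM XpolyC mul0r add0r.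
  have kP : (k%:MP : P) != 0 by rewrite mpolyC_eq0.
  move: E; rewrite hE XpolyC mulr0 subr0 expr2 mulrA => /(mulIf kP) ->.
  by rewrite mulrCA -mpolyCM mulVf// mulr1.
have [l [c0 [gE LE]]] := affine_of_affine_derivative L2 Xg.
have expE r : expfrac g h r = cexp (l * r ord0 ix + c0).
  rewrite /expfrac hE /peval mevalC mulrC -mevalZ gE mevalD mevalC mevalZ mevalXU.
  by rewrite addrC.
have hr r : peval h r != 0 by rewrite hE /peval mevalC.
exists l, c0; split; [|exact: LE|by move=> r; split; [exact: hr|exact: expE]].
by apply/eqP => l0; apply: Epq; rewrite !expE l0 !mul0r.
Qed.

Lemma cexp1_neq1 : cexp (1 : C R) != 1.
Proof.
apply/eqP => /(congr1 (@complex.Re R)) /=; rewrite cos0 mulr1 -expR0 => /expR_inj/eqP.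
by rewrite expR0 oner_eq0.
Qed.

Lemma exp_factor_ofN (l c0 : C R) : l != 0 ->
  exp_factor_of a b c (c0%:MP + l *: px R) 1 (l *: py R) /\
  forall p, expfrac (c0%:MP + l *: px R) 1 p = cexp (l * p ord0 ix + c0).
Proof.
move=> l0; have expE p : expfrac (c0%:MP + l *: px R) 1 p = cexp (l * p ord0 ix + c0).
  by rewrite /expfrac /peval meval1 divr1 mevalD mevalC mevalZ mevalXU addrC.
have eval1 p : peval (1 : P) p != 0 by rewrite /peval meval1 oner_neq0.
split=> //; split.
- split; first exact: oner_neq0.
  by move=> d u v _ E; apply/unitrPr; exists v.
(* The values of l x + c0 at these two points differ by 1, and [cexp 1] is not 1. *)
- exists 0, (\row_i l^-1); split=> //; rewrite !expE !mxE mulr0 add0r mulfV// addrC cexpD.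
  by move/eqP; rewrite -{1}[cexp c0]mulr1 (inj_eq (mulfI (cexp_neq0 _))) eq_sym (negbTE cexp1_neq1).
- by apply: leq_trans (msizeZ_le _ _) _; rewrite msizeX mdeg1.
move=> p p0; rewrite Xfun_expfrac// Xpoly_affine -mpolyC1 XpolyC mulr0 subr0.
by rewrite mpolyC1 mulr1 [peval 1 p]meval1 expr1n divr1 mulrC.
Qed.

Lemma exp_factor_iff (E : point -> C R) L :
  exp_factor a b c E L <-> exists l c0 : C R,
    [/\ l != 0, E =1 (fun p => cexp (l * p ord0 ix + c0)) & L = l *: py R].
Proof.
split=> [[g [h [/exp_factor_ofP[l [c0 [l0 LE expE]]] EE]]]|[l [c0 [l0 EE LE]]]].
  by exists l, c0; split=> // p; rewrite EE (expE p).2.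
have [ef expE] := exp_factor_ofN c0 l0.
by exists (c0%:MP + l *: px R), 1; rewrite LE; split=> // p; rewrite EE expE.
Qed.

End ExpFactors.

(** * First integrals of Darboux type *)

Lemma sub_swap (V : zmodType) (x y z t : V) : x - y = z - t -> x - z = y - t.
Proof. by move=> /(canRL (subrK _)) ->; rewrite addrAC [z - t]addrC addrK addrC. Qed.

Lemma expr_ratio (F : fieldType) (x y z : F) (m n : nat) : y != 0 ->
  (x * y ^+ n) ^+ m / (z * y ^+ m) ^+ n = x ^+ m / z ^+ n.
Proof.
move=> y0; rewrite !exprMn -!exprM mulnC invfM mulrACA divff ?mulr1//.
by rewrite expf_neq0.
Qed.

(** The factors 0 and 1 are the partial derivatives of x and y. When [w] is nonzero, y is invertible
    and [al] is 0, so the term in x / y disappears. *)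
Lemma log_derivative_eq0 (F : fieldType) (E x y z al w t : F) : E != 0 ->
  w = 0 \/ y != 0 -> w = 0 \/ al = 0 ->
  y * (E * (w * 0 / y + t * 1)) + (- al * x + y * z) * (E * (w * 1 / y + t * 0)) = 0 ->
  y * t + z * w = 0.
Proof.
move=> E0 yw alw S; apply: (mulfI E0); rewrite mulr0 -S {S}.
case: yw alw => [-> _|y0 [->|->]]; try by rewrite !(mul0r, mulr0, mulr1, addr0, add0r); ring.
by field.
Qed.

Section DarbouxIntegral.
Variables (R : realType) (a b c : R).
Notation P := {mpoly (C R)[3]}.
Notation point := 'rV[C R]_3.
Notation e i := (delta_mx ord0 i : point).

Lemma cexpN (z : C R) : cexp (- z) = (cexp z)^-1.
Proof. by apply: (mulIf (cexp_neq0 z)); rewrite -cexpD addNr cexp0 mulVf// cexp_neq0. Qed.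

Lemma cexpMn (n : nat) (z : C R) : cexp (n%:R * z) = cexp z ^+ n.
Proof.
elim: n => [|n IH]; first by rewrite mul0r cexp0.
by rewrite -natr1 mulrDl mul1r cexpD IH exprSr.
Qed.

Lemma cexp_sum (n : nat) (z : 'I_n -> C R) : cexp (\sum_(i < n) z i) = \prod_(i < n) cexp (z i).
Proof. by rewrite (big_morph _ (@cexpD R) (cexp0 R)). Qed.

Lemma XfunE (F : point -> C R) (p : point) (dx dy : C R) :
  is_derive p (e ix) F dx -> is_derive p (e iy) F dy -> is_derive p (e iz) F 0 ->
  Xfun a b c F p = p ord0 iy * dx +
    (- (a%:C%C : C R) * p ord0 ix + p ord0 iy * p ord0 iz) * dy.
Proof.
move=> Fx Fy Fz.
have Fx' : 'D_(e ix) F p = dx by exact: derive_val.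
have Fy' : 'D_(e iy) F p = dy by exact: derive_val.
have Fz' : 'D_(e iz) F p = 0 by exact: derive_val.
have sx : peval (system a b c ix) p = p ord0 iy by exact: mevalXU.
have sy : peval (system a b c iy) p = - (a%:C%C : C R) * p ord0 ix + p ord0 iy * p ord0 iz.
  have -> : system a b c iy = - (a%:C%C : C R) *: px R + py R * pz R by [].
  by rewrite /peval mevalD mevalZ mevalM !mevalXU.
by rewrite /Xfun sum_ord3 sx sy Fx' Fy' Fz' [X in _ + X](mulr0 _) [LHS](addr0 _).
Qed.

Section Branches.
Variables (U : set point) (p0 : point).
Hypotheses (Uo : open U) (Uc : connected U) (Up0 : U p0).

Lemma cexp_constant (l : point -> C R) (x : C R) :
  (forall p, U p -> {for p, continuous l}) -> (forall p, U p -> cexp (l p) = x) ->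
  forall p, U p -> l p = l p0.
Proof.
move=> lc lx p Up; apply: (locally_constant Uo Uc lc) => // {Up} {}p Up.
near=> q; rewrite !lx//; near: q; exact: open_nbhs_nbhs.
Unshelve. all: by end_near. Qed.

(** All [f j] are of the form k_j y^(q_j) with q_j > 0, so up to a constant the sum is [w] log y
    with [w] the sum of the [lambda j * q_j]. A branch of log y on [U] is supplied by [l ord0]
    divided by q_0. *)
Lemma darboux_branch (m : nat) (f : 'I_m -> P) (lambda : 'I_m -> C R)
    (l : 'I_m -> point -> C R) :
  (forall j, exists K, darboux a b c (f j) K) ->
  (forall j p, U p -> {for p, continuous (l j)}) ->
  (forall j p, U p -> cexp (l j p) = peval (f j) p) ->
  exists (w : C R) (W : point -> C R), [/\ w = 0 -> forall p, U p -> W p = W p0,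
    w = 0 \/ a = 0,
    forall p, U p -> w = 0 \/ p ord0 iy != 0,
    forall p, U p -> forall i, is_derive p (e i) W (w * (iy == i)%:R / p ord0 iy) &
    forall p, U p -> \sum_(j < m) lambda j * l j p =
      W p + (\sum_(j < m) lambda j * l j p0 - W p0)].
Proof.
case: m f lambda l => [|m] f lambda l fK lc lf.
  (* An empty product gives no information on [a] or on the zeros of y, hence the alternatives
     [w = 0] in the conclusion. *)
  exists 0, (cst 0); split=> //; [by left|by left| |by move=> p _; rewrite !big_ord0 add0r subrr].
  by move=> p _ i; rewrite !mul0r; exact: is_derive_cst.
have a0 : a = 0.
  apply/eqP; apply: contrapT => /negP a0; have [K [fn E]] := fK ord0.
  by have [k _ /fn] := darboux_trivial (nonconstant_neq0 fn) E (or_introl a0).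
have /choice[kq kqE] : forall j, exists kq : C R * nat,
    kq.1 != 0 /\ f j = kq.1 *: py R ^+ kq.2.+1.
  move=> j; have [K [fn E]] := fK j.
  have [k [[|q] [k0 fE _]]] := darboux_power a0 (nonconstant_neq0 fn) E.
    by case: (fn k); rewrite fE expr0 alg_mpolyC.
  by exists (k, q).
pose k j := (kq j).1; pose q j := (kq j).2.+1.
have fE j p : peval (f j) p = k j * p ord0 iy ^+ q j.
  by rewrite (kqE j).2 /peval mevalZ rmorphXn /= mevalXU.
have y0 p : U p -> p ord0 iy != 0.
  move=> Up; apply/eqP => y0; have := cexp_neq0 (l ord0 p).
  by rewrite lf// fE y0 expr0n mulr0 eqxx.
have q0 : (q ord0)%:R != 0 :> C R by rewrite pnatr_eq0.
pose w := \sum_(j < m.+1) lambda j * (q j)%:R.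
exists w, (fun p => w / (q ord0)%:R * l ord0 p); split.
- by move=> -> p _; rewrite !mul0r.
- by right.
- by move=> p Up; right; exact: y0.
- move=> p Up i; have y0p := y0 p Up.
  have Df : is_derive p (e i) (peval (f ord0))
      (k ord0 *: (((q ord0)%:R * p ord0 iy ^+ (q ord0).-1) *: (iy == i)%:R)).
    rewrite (_ : peval _ = k ord0 \*: ((fun r : point => r ord0 iy) ^+ q ord0)); last first.
      by apply/funext => r; rewrite fE exprfctE.
    have := is_derive_coord p (e i) iy; rewrite mxE eqxx /= => D.
    exact: (is_deriveZ _ (is_deriveX _ D)).
  have Dl : is_derive p (e i) (l ord0) ((q ord0)%:R * (iy == i)%:R / p ord0 iy).
    have := is_derive_clog (lc ord0 p Up) _ Df.
    have near_lf : \forall x \near p, cexp (l ord0 x) = peval (f ord0) x.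
      by near=> x; apply: lf; near: x; exact: open_nbhs_nbhs.
    move=> /(_ near_lf) D; apply: (is_derive_eq D); rewrite fE /GRing.scale /=.
    have k0 : k ord0 != 0 by case: (kqE ord0).
    have yq : p ord0 iy ^+ (q ord0).-1 != 0 by rewrite expf_neq0.
    rewrite /q in yq *; rewrite exprS /= in yq *.
    move: (p ord0 iy) (p ord0 iy ^+ (kq ord0).2) y0p yq k0 => x y x0 y0' k0.
    by field; rewrite x0 y0' k0.
  apply: (is_derive_eq (is_deriveZ (w / (q ord0)%:R) Dl)).
  by rewrite /GRing.scale /= !mulrA divfK.
move=> p Up.
(* The exponential of [q_0 l_j - q_j l_0] is the constant k_j^(q_0) / k_0^(q_j), as the powers of y
   cancel; so this difference is constant on the connected set [U]. *)
have lj j : (q ord0)%:R * (l j p - l j p0) = (q j)%:R * (l ord0 p - l ord0 p0).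
  rewrite !mulrBr; apply: sub_swap; pose x := k j ^+ q ord0 / k ord0 ^+ q j.
  pose g r := (q ord0)%:R * l j r - (q j)%:R * l ord0 r.
  have gc r : U r -> {for r, continuous g}.
    move=> Ur; change (g y @[y --> r] --> g r); apply: (@cvgB _ _ _ (nbhs r)).
      by apply: (@cvgM _ _ (nbhs r)); [exact: cvg_cst | exact: lc].
    by apply: (@cvgM _ _ (nbhs r)); [exact: cvg_cst | exact: lc].
  have gx r : U r -> cexp (g r) = x.
    by move=> Ur; rewrite cexpD cexpN !cexpMn !lf// !fE; apply: expr_ratio; exact: y0.
  exact: (cexp_constant gc gx Up).
have key : \sum_(j < m.+1) lambda j * l j p - \sum_(j < m.+1) lambda j * l j p0
    = w / (q ord0)%:R * (l ord0 p - l ord0 p0).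
  rewrite -sumrB /w mulr_suml mulr_suml; apply: eq_bigr => j _.
  rewrite -mulrBr -!mulrA; congr (_ * _).
  by apply: (mulfI q0); rewrite lj mulrCA; congr (_ * _); rewrite mulVKf.
by rewrite addrCA -mulrBr -key addrC subrK.
Unshelve. all: by end_near. Qed.

End Branches.

Lemma no_darboux_integral (U : set point) (H : point -> C R) :
  ~ darboux_first_integral a b c U H.
Proof.
move=> [[Uo Uc [p0 Up0]] [m [n [f [g [h [lambda [mu [phi [psi [fK ghE phiE psiE HE]]]]]]]]]]].
move=> [p1 [p2 [Up1 Up2 Hn]]] XH.
have /choice[lf lfE] := phiE; have /choice[lg lgE] := psiE.
have lfc j p : U p -> {for p, continuous (lf j)} by move=> Up; exact: (lfE j).1.
have lff j p : U p -> cexp (lf j p) = peval (f j) p by move=> Up; have [] := (lfE j).2 p Up.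
have lgc j p : U p -> {for p, continuous (lg j)} by move=> Up; exact: (lgE j).1.
have lgg j p : U p -> cexp (lg j p) = expfrac (g j) (h j) p by move=> Up; have [] := (lgE j).2 p Up.
have [w [W [W0 aw yw DW WE]]] := darboux_branch Uo Uc Up0 lambda fK lfc lff.
have /choice[lc lcE] : forall j, exists lc : C R * C R,
    forall p, expfrac (g j) (h j) p = cexp (lc.1 * p ord0 ix + lc.2).
  move=> j; have [[L /exp_factor_ofP[l [c0 [_ _ E]]]] _] := ghE j.
  by exists (l, c0) => p; case: (E p).
(* The branch [lg j] is a logarithm of e^(l x + c0), so [lg j] minus l x is a continuous logarithm
   of a constant. *)
have lgl j p : U p -> lg j p - (lc j).1 * p ord0 ix = lg j p0 - (lc j).1 * p0 ord0 ix.
  move=> Up; pose G r := lg j r - (lc j).1 * (r : point) ord0 ix.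
  have Gc r : U r -> {for r, continuous G}.
    move=> Ur; change (G y @[y --> r] --> G r); apply: (@cvgB _ _ _ (nbhs r)).
      exact: lgc.
    by apply: (@cvgM _ _ (nbhs r)); [exact: cvg_cst | exact: coord_continuous].
  have Gx r : U r -> cexp (G r) = cexp (lc j).2.
    move=> Ur; rewrite cexpD cexpN lgg// lcE cexpD mulrAC divff ?mul1r//.
    exact: cexp_neq0.
  exact: (cexp_constant Uo Uc Up0 Gc Gx Up).
pose t := \sum_(k < n) mu k * (lc k).1.
have [kappa HL] : exists kappa, forall p, U p -> H p = cexp (W p + t * p ord0 ix + kappa).
  exists (\sum_(j < m) lambda j * lf j p0 - W p0 +
          \sum_(k < n) mu k * (lg k p0 - (lc k).1 * p0 ord0 ix)) => p Up.
  have Ephi : \prod_(j < m) phi j p = cexp (\sum_(j < m) lambda j * lf j p).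
    by rewrite cexp_sum; apply: eq_bigr => j _; exact: ((lfE j).2 p Up).2.
  have Epsi : \prod_(k < n) psi k p = cexp (\sum_(k < n) mu k * lg k p).
    by rewrite cexp_sum; apply: eq_bigr => k _; exact: ((lgE k).2 p Up).2.
  have Elg : \sum_(k < n) mu k * lg k p =
      t * p ord0 ix + \sum_(k < n) mu k * (lg k p0 - (lc k).1 * p0 ord0 ix).
    rewrite /t mulr_suml -big_split; apply: eq_bigr => k _ /=.
    by rewrite -(lgl k p Up) -mulrA -mulrDr addrC subrK.
  by rewrite (HE p Up) Ephi Epsi -cexpD WE// Elg addrACA.
have DL p i : U p -> is_derive p (e i) H (cexp (W p + t * p ord0 ix + kappa) *
    (w * (iy == i)%:R / p ord0 iy + t * (ix == i)%:R)).
  move=> Up.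
  have Dx : is_derive p (e i) (fun r : point => r ord0 ix) (ix == i)%:R.
    by have := is_derive_coord p (e i) ix; rewrite mxE eqxx.
  have DWt := is_deriveD (is_deriveD (DW p Up i) (is_deriveZ t Dx)) (is_derive_cst kappa p (e i)).
  have D := is_derive_cexp DWt.
  apply: (@near_eq_is_derive _ _ _ _ H p (e i) _ _ (is_derive_eq D _)).
    by near=> r; rewrite HL//; near: r; exact: open_nbhs_nbhs.
  by rewrite addr0.
(* This is the logarithmic derivative of [H] along X, with [W] contributing [w] z and [t] x
   contributing [t] y. *)
have lin p : U p -> p ord0 iy * t + p ord0 iz * w = 0.
  move=> Up; pose E := cexp (W p + t * p ord0 ix + kappa); pose y := p ord0 iy.
  have Dx : is_derive p (e ix) H (E * (w * 0 / y + t * 1)) by exact: DL.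
  have Dy : is_derive p (e iy) H (E * (w * 1 / y + t * 0)) by exact: DL.
  have Dz : is_derive p (e iz) H 0.
    by apply: (is_derive_eq (DL p iz Up)); rewrite mulr0 mul0r mulr0 addr0 mulr0.
  have aw' : w = 0 \/ (a%:C%C : C R) = 0 by case: aw => [|->]; [left | right].
  have := XH p Up; rewrite (XfunE Dx Dy Dz).
  exact: (log_derivative_eq0 (cexp_neq0 _) (yw p Up) aw').
(* Since [U] is open, one can move from [p0] inside [U] along each axis; subtracting the relation
   [lin] at [p0] isolates [t] along y and [w] along z. *)
have shift i : exists2 s : C R, s != 0 & U (s *: e i + p0).
  have nearU : \forall s \near (0 : C R)^', U (s *: e i + p0).
    by apply: (@cvg_line _ _ p0 (e i)); exact: open_nbhs_nbhs.
  have near0 : \forall s \near (0 : C R)^', s != 0 by exact: nbhs_dnbhs_neq.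
  by have [s [Us s0]] := filter_ex (filterI nearU near0); exists s.
have t0 : t = 0.
  have [s s0 Us] := shift iy; have := lin _ Us; rewrite !mxE /= mulr1 mulr0 add0r.
  rewrite mulrDl -addrA lin// addr0 => /eqP.
  by rewrite mulf_eq0 (negbTE s0) => /eqP.
have w0 : w = 0.
  have [s s0 Us] := shift iz; have := lin _ Us; rewrite !mxE /= mulr1 mulr0 add0r.
  rewrite mulrDl addrCA lin// addr0 => /eqP.
  by rewrite mulf_eq0 (negbTE s0) => /eqP.
by apply: Hn; rewrite !HL// t0 !mul0r !(W0 w0).
Unshelve. all: by end_near. Qed.

End DarbouxIntegral.

Theorem theorem2 (R : realType) (a b c : R) :
  (~ exists f : {mpoly (C R)[3]}, polynomial_first_integral a b c f)
  /\
  (((exists f : {mpoly (C R)[3]}, unique_irreducible_darboux a b c f) <-> a = 0)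
   /\
   (a = 0 ->
      unique_irreducible_darboux a b c (py R) /\ darboux a b c (py R) (pz R)))
  /\
  (~ exists f : {fraction {mpoly (C R)[3]}}, rational_first_integral a b c f)
  /\
  (forall (E : 'rV[C R]_3 -> C R) (L : {mpoly (C R)[3]}),
     exp_factor a b c E L <->
     exists l c0 : C R,
       [/\ l != 0, E =1 (fun p => cexp (l * p ord0 ix + c0)) &
           L = l *: py R])
  /\
  (~ exists (U : set 'rV[C R]_3) (H : 'rV[C R]_3 -> C R),
       darboux_first_integral a b c U H).
Proof.
split; first by case=> f; exact: no_polynomial_first_integral.
split; first by split; [exact: unique_darboux_iff | exact: unique_py].
split; first by case=> f; exact: no_rational_first_integral.
split; first by move=> E L; exact: exp_factor_iff.
by case=> U [H]; exact: no_darboux_integral.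
Qed.
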